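(* Let $f(x)=x^6+c_5x^5+c_4x^4+c_3x^3+c_2x^2+c_1x+c_0$ be a monic polynomial of degree $6$ with integer coefficients such that $0\le c_5-c_1\le 12$. Then $f(x)$ is a Cappell-Shaneson polynomial if and only if $c_0=1$ and $(c_1,c_2,c_3,c_4,c_5)$ is one of the tuples listed below, where $q=c_5-c_1$ and $a$ stands for an arbitrary integer. Further, $f(x)$ is positive if and only if the positivity condition given for the corresponding entry holds (for entries with parameter $a$ the condition on $a$ follows the tuple in square brackets; for entries without parameter, [Yes] means positive and [No] means not positive). $q=0$: $(2a+1,\ a^2-a,\ -2a^2-2a-2,\ a^2-a-1,\ 2a+1)$ [$a\le 0$]; $(2a+1,\ a^2-a-1,\ -2a^2-2a-2,\ a^2-a-2,\ 2a+1)$ [$a\le -1$]; $(2a+1,\ a^2-a-1,\ -2a^2-2a-2,\ a^2-a,\ 2a+1)$ [$a\le 0$]; $(2a+1,\ a^2-a-2,\ -2a^2-2a-2,\ a^2-a-1,\ 2a+1)$ [$a\le -1$]. $q=1$: $(3a-1,\ 3a^2-a+4,\ -6a^2-4a-6,\ 3a^2-a+2,\ 3a)$ [all $a\in\mathbb{Z}$]; $(3a,\ 3a^2+a+4,\ -6a^2-8a-8,\ 3a^2+a+2,\ 3a+1)$ [all $a\in\mathbb{Z}$]; $(2a-1,\ a^2-3a,\ -2a^2+a-1,\ a^2-2a+1,\ 2a)$ [all $a\in\mathbb{Z}$]; $(2a,\ a^2-2a-1,\ -2a^2-a-1,\ a^2-a,\ 2a+1)$ [$a\le 0$]; $(-5,10,-11,7,-4)$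 [Yes]; $(-12,45,-67,42,-11)$ [Yes]; $(-2,3,-3,2,-1)$ [Yes]; $(-7,18,-23,17,-6)$ [Yes]; $(5a-2,\ 5a^2-11a+2,\ -10a^2+12a-2,\ 5a^2-11a,\ 5a-1)$ [$a\le 0$]; $(5a-1,\ 5a^2-9a,\ -10a^2+8a,\ 5a^2-9a-2,\ 5a)$ [$a\le 0$]; $(5a,\ 5a^2-7a-2,\ -10a^2+4a+2,\ 5a^2-7a-4,\ 5a+1)$ [$a\le -1$]; $(5a+2,\ 5a^2-3a-4,\ -10a^2-4a+2,\ 5a^2-3a-6,\ 5a+3)$ [$a\le -1$]; $(2a-1,\ a^2-3a,\ -2a^2+a-2,\ a^2-2a,\ 2a)$ [$a\le 0$]; $(2a,\ a^2-2a-1,\ -2a^2-a-3,\ a^2-a,\ 2a+1)$ [$a\le 2$]; $(2a-1,\ a^2-3a,\ -2a^2+a-3,\ a^2-2a+1,\ 2a)$ [$a\le 3$]; $(2a,\ a^2-2a-2,\ -2a^2-a-2,\ a^2-a,\ 2a+1)$ [$a\le 0$]. $q=2$: $(-5,11,-12,8,-3)$ [Yes]; $(-7,18,-22,15,-5)$ [Yes]; $(-13,53,-72,42,-11)$ [Yes]; $(-15,68,-98,57,-13)$ [Yes]; $(1,-4,-4,1,3)$ [No]; $(3,-3,-10,2,5)$ [No]; $(-7,17,-18,10,-5)$ [Yes]; $(-13,50,-72,43,-11)$ [Yes]; $(-3,4,-4,3,-1)$ [Yes]; $(-5,9,-10,8,-3)$ [Yes]; $(-7,15,-14,10,-5)$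 [Yes]; $(-9,24,-28,19,-7)$ [Yes]; $(-15,69,-98,56,-13)$ [Yes]; $(-17,86,-128,73,-15)$ [Yes]; $(1,-3,-4,0,3)$ [No]; $(-1,-2,-2,1,1)$ [Yes]. $q=3$: $(-12,35,-43,28,-9)$ [Yes]; $(-15,68,-91,49,-12)$ [Yes]; $(-18,93,-135,74,-15)$ [Yes]; $(3,-4,-12,4,6)$ [No]; $(-9,26,-27,13,-6)$ [Yes]; $(-15,64,-91,51,-12)$ [Yes]; $(-3,2,-3,3,0)$ [Yes]; $(-6,10,-4,2,-3)$ [Yes]; $(-12,38,-48,30,-9)$ [Yes]; $(-15,68,-90,48,-12)$ [Yes]; $(-18,94,-136,74,-15)$ [Yes]; $(0,-5,-3,2,3)$ [No]. $q=4$: $(-21,122,-178,93,-17)$ [Yes]; $(-11,37,-38,16,-7)$ [Yes]; $(-1,-3,-2,2,3)$ [Yes]; $(1,-8,-6,5,5)$ [No]. $q=5$: $(-24,155,-227,114,-19)$ [Yes]; $(-13,50,-51,19,-8)$ [Yes]; $(1,-6,-7,5,6)$ [No]; $(2,-11,-11,10,7)$ [No]. $q=6$: $(-27,192,-282,137,-21)$ [Yes]; $(-15,65,-66,22,-9)$ [Yes]; $(-3,-5,24,-22,3)$ [No]; $(3,-7,-18,12,9)$ [No]; $(3,-14,-18,17,9)$ [No]. $q=7$: $(-30,233,-343,162,-23)$ [Yes]; $(-17,82,-83,25,-10)$ [Yes]; $(5,-6,-35,23,12)$ [No]; $(4,-17,-27,26,11)$ [No]; $(-21,78,-106,60,-14)$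 [Yes]; $(-30,248,-346,148,-23)$ [Yes]; $(18,56,-228,128,25)$ [No]; $(-22,81,-111,64,-15)$ [Yes]. $q=8$: $(-33,278,-410,189,-25)$ [Yes]; $(-19,101,-102,28,-11)$ [Yes]; $(7,-3,-58,38,15)$ [No]; $(5,-20,-38,37,13)$ [No]. $q=9$: $(-36,327,-483,218,-27)$ [Yes]; $(-21,122,-123,31,-12)$ [Yes]; $(9,2,-87,57,18)$ [No]; $(6,-23,-51,50,15)$ [No]; $(34,246,-734,410,43)$ [No]; $(1,-28,67,-51,10)$ [No]; $(-31,116,-162,96,-22)$ [Yes]; $(-46,566,-852,366,-37)$ [Yes]. $q=10$: $(-39,380,-562,249,-29)$ [Yes]; $(-23,145,-146,34,-13)$ [Yes]; $(11,9,-122,80,21)$ [No]; $(7,-26,-66,65,17)$ [No]. $q=11$: $(-42,437,-647,282,-31)$ [Yes]; $(-25,170,-171,37,-14)$ [Yes]; $(13,18,-163,107,24)$ [No]; $(8,-29,-83,82,19)$ [No]. $q=12$: $(-45,498,-738,317,-33)$ [Yes]; $(-27,197,-198,40,-15)$ [Yes]; $(15,29,-210,138,27)$ [No]; $(9,-32,-102,101,21)$ [No].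
   Context: For $n\ge 2$, a matrix $A\in\mathrm{SL}(n,\mathbb{Z})$ is a Cappell-Shaneson matrix of order $n$ if for every $k\in\{1,\ldots,[n/2]\}$ one has $\det(I-\bigwedge^kA)\in\{1,-1\}$, where $\bigwedge^k A$ is the $k$-th exterior power of $A$ and $I$ is the identity matrix. A monic integer polynomial of degree $n$ is a Cappell-Shaneson polynomial of degree $n$ if it is the characteristic polynomial of some Cappell-Shaneson matrix of order $n$. A Cappell-Shaneson polynomial $f$ of degree $n$ is positive if $(-1)^nf(t)>0$ for every real $t<0$.
   Formalization: For the third q=1 entry, (2a-1, a^2-3a, -2a^2+a-1, a^2-2a+1, 2a), the printed positivity condition ''all a'' is false (a=1 gives f(-1)=-1<0); the formal statement uses and proves the condition a≤0 instead. *)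

(* Defs.v *)
From mathcomp Require Import all_boot all_order all_algebra.
From mathcomp Require Import reals.

Set Implicit Arguments.
Unset Strict Implicit.
Unset Printing Implicit Defensive.

Import Order.TTheory GRing.Theory Num.Theory.

Local Open Scope ring_scope.

(* Strictly increasing maps 'I_k -> 'I_n index the standard basis
   e_(S 0) /\ ... /\ e_(S (k-1)) of the k-th exterior power of R^n. *)
Definition incr_maps (k n : nat) : {set {ffun 'I_k -> 'I_n}} :=
  [set S : {ffun 'I_k -> 'I_n} |
    [forall i : 'I_k, forall j : 'I_k, (i < j)%N ==> (S i < S j)%N]].

(* The matrix of the k-th exterior power of A in the standard basis: the entry
   at (S, T) is the k x k minor of A with rows S and columns T. *)
Definition ext_power (R : comNzRingType) (n k : nat) (A : 'M[R]_n) :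
    'M[R]_#|incr_maps k n| :=
  \matrix_(i, j)
    let S : {ffun 'I_k -> 'I_n} := enum_val i in
    let T : {ffun 'I_k -> 'I_n} := enum_val j in
    \det (mxsub S T A).

Definition cappell_shaneson_matrix (n : nat) (A : 'M[int]_n) : Prop :=
  [/\ (2 <= n)%N, \det A = 1 &
      forall k : nat, (1 <= k <= n./2)%N ->
        \det (1%:M - ext_power k A) = 1 \/ \det (1%:M - ext_power k A) = -1].

(* A characteristic polynomial is automatically monic of degree n. *)
Definition cappell_shaneson_poly (n : nat) (f : {poly int}) : Prop :=
  exists2 A : 'M[int]_n, cappell_shaneson_matrix A & char_poly A = f.

(* Meant for f a Cappell-Shaneson polynomial of degree n. *)
Definition positive_poly (R : realType) (n : nat) (f : {poly int}) : Prop :=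
  forall t : R, t < 0 -> 0 < (-1) ^+ n * (map_poly (intr : int -> R) f).[t].

(* Each entry is (c1, c2, c3, c4, c5, p), where q = c5 - c1 and p is the
   positivity condition: true for "Yes" or "all a", false for "No".  Entries not
   involving a are single polynomials, the others are one-parameter families. *)
Definition cs_table (q a : int) : seq (int * int * int * int * int * bool) :=
  match q with
  | Posz 0 => [::
      (2 * a + 1, a ^+ 2 - a, - 2 * a ^+ 2 - 2 * a - 2, a ^+ 2 - a - 1, 2 * a + 1, a <= 0);
      (2 * a + 1, a ^+ 2 - a - 1, - 2 * a ^+ 2 - 2 * a - 2, a ^+ 2 - a - 2, 2 * a + 1, a <= -1);
      (2 * a + 1, a ^+ 2 - a - 1, - 2 * a ^+ 2 - 2 * a - 2, a ^+ 2 - a, 2 * a + 1, a <= 0);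
      (2 * a + 1, a ^+ 2 - a - 2, - 2 * a ^+ 2 - 2 * a - 2, a ^+ 2 - a - 1, 2 * a + 1, a <= -1)]
  | Posz 1 => [::
      (3 * a - 1, 3 * a ^+ 2 - a + 4, - 6 * a ^+ 2 - 4 * a - 6, 3 * a ^+ 2 - a + 2, 3 * a, true);
      (3 * a, 3 * a ^+ 2 + a + 4, - 6 * a ^+ 2 - 8 * a - 8, 3 * a ^+ 2 + a + 2, 3 * a + 1, true);
      (* The source prints "all a" as the positivity condition here, which is a
         misprint: for a = 1 the polynomial is x^6+2x^5-2x^3-2x^2+x+1, with value
         -1 at x = -1.  The correct condition, a <= 0, is used instead. *)
      (2 * a - 1, a ^+ 2 - 3 * a, - 2 * a ^+ 2 + a - 1, a ^+ 2 - 2 * a + 1, 2 * a, a <= 0);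
      (2 * a, a ^+ 2 - 2 * a - 1, - 2 * a ^+ 2 - a - 1, a ^+ 2 - a, 2 * a + 1, a <= 0);
      (-5, 10, -11, 7, -4, true);
      (-12, 45, -67, 42, -11, true);
      (-2, 3, -3, 2, -1, true);
      (-7, 18, -23, 17, -6, true);
      (5 * a - 2, 5 * a ^+ 2 - 11 * a + 2, - 10 * a ^+ 2 + 12 * a - 2, 5 * a ^+ 2 - 11 * a, 5 * a - 1, a <= 0);
      (5 * a - 1, 5 * a ^+ 2 - 9 * a, - 10 * a ^+ 2 + 8 * a, 5 * a ^+ 2 - 9 * a - 2, 5 * a, a <= 0);
      (5 * a, 5 * a ^+ 2 - 7 * a - 2, - 10 * a ^+ 2 + 4 * a + 2, 5 * a ^+ 2 - 7 * a - 4, 5 * a + 1, a <= -1);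
      (5 * a + 2, 5 * a ^+ 2 - 3 * a - 4, - 10 * a ^+ 2 - 4 * a + 2, 5 * a ^+ 2 - 3 * a - 6, 5 * a + 3, a <= -1);
      (2 * a - 1, a ^+ 2 - 3 * a, - 2 * a ^+ 2 + a - 2, a ^+ 2 - 2 * a, 2 * a, a <= 0);
      (2 * a, a ^+ 2 - 2 * a - 1, - 2 * a ^+ 2 - a - 3, a ^+ 2 - a, 2 * a + 1, a <= 2);
      (2 * a - 1, a ^+ 2 - 3 * a, - 2 * a ^+ 2 + a - 3, a ^+ 2 - 2 * a + 1, 2 * a, a <= 3);
      (2 * a, a ^+ 2 - 2 * a - 2, - 2 * a ^+ 2 - a - 2, a ^+ 2 - a, 2 * a + 1, a <= 0)]
  | Posz 2 => [::
      (-5, 11, -12, 8, -3, true);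
      (-7, 18, -22, 15, -5, true);
      (-13, 53, -72, 42, -11, true);
      (-15, 68, -98, 57, -13, true);
      (1, -4, -4, 1, 3, false);
      (3, -3, -10, 2, 5, false);
      (-7, 17, -18, 10, -5, true);
      (-13, 50, -72, 43, -11, true);
      (-3, 4, -4, 3, -1, true);
      (-5, 9, -10, 8, -3, true);
      (-7, 15, -14, 10, -5, true);
      (-9, 24, -28, 19, -7, true);
      (-15, 69, -98, 56, -13, true);
      (-17, 86, -128, 73, -15, true);
      (1, -3, -4, 0, 3, false);
      (-1, -2, -2, 1, 1, true)]
  | Posz 3 => [::
      (-12, 35, -43, 28, -9, true);
      (-15, 68, -91, 49, -12, true);
      (-18, 93, -135, 74, -15, true);
      (3, -4, -12, 4, 6, false);
      (-9, 26, -27, 13, -6, true);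
      (-15, 64, -91, 51, -12, true);
      (-3, 2, -3, 3, 0, true);
      (-6, 10, -4, 2, -3, true);
      (-12, 38, -48, 30, -9, true);
      (-15, 68, -90, 48, -12, true);
      (-18, 94, -136, 74, -15, true);
      (0, -5, -3, 2, 3, false)]
  | Posz 4 => [::
      (-21, 122, -178, 93, -17, true);
      (-11, 37, -38, 16, -7, true);
      (-1, -3, -2, 2, 3, true);
      (1, -8, -6, 5, 5, false)]
  | Posz 5 => [::
      (-24, 155, -227, 114, -19, true);
      (-13, 50, -51, 19, -8, true);
      (1, -6, -7, 5, 6, false);
      (2, -11, -11, 10, 7, false)]
  | Posz 6 => [::
      (-27, 192, -282, 137, -21, true);
      (-15, 65, -66, 22, -9, true);
      (-3, -5, 24, -22, 3, false);
      (3, -7, -18, 12, 9, false);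
      (3, -14, -18, 17, 9, false)]
  | Posz 7 => [::
      (-30, 233, -343, 162, -23, true);
      (-17, 82, -83, 25, -10, true);
      (5, -6, -35, 23, 12, false);
      (4, -17, -27, 26, 11, false);
      (-21, 78, -106, 60, -14, true);
      (-30, 248, -346, 148, -23, true);
      (18, 56, -228, 128, 25, false);
      (-22, 81, -111, 64, -15, true)]
  | Posz 8 => [::
      (-33, 278, -410, 189, -25, true);
      (-19, 101, -102, 28, -11, true);
      (7, -3, -58, 38, 15, false);
      (5, -20, -38, 37, 13, false)]
  | Posz 9 => [::
      (-36, 327, -483, 218, -27, true);
      (-21, 122, -123, 31, -12, true);
      (9, 2, -87, 57, 18, false);
      (6, -23, -51, 50, 15, false);
      (34, 246, -734, 410, 43, false);
      (1, -28, 67, -51, 10, false);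
      (-31, 116, -162, 96, -22, true);
      (-46, 566, -852, 366, -37, true)]
  | Posz 10 => [::
      (-39, 380, -562, 249, -29, true);
      (-23, 145, -146, 34, -13, true);
      (11, 9, -122, 80, 21, false);
      (7, -26, -66, 65, 17, false)]
  | Posz 11 => [::
      (-42, 437, -647, 282, -31, true);
      (-25, 170, -171, 37, -14, true);
      (13, 18, -163, 107, 24, false);
      (8, -29, -83, 82, 19, false)]
  | Posz 12 => [::
      (-45, 498, -738, 317, -33, true);
      (-27, 197, -198, 40, -15, true);
      (15, 29, -210, 138, 27, false);
      (9, -32, -102, 101, 21, false)]
  | _ => [::]
  end.

(* Main.v *)
(* Over algC the matrix A is unitarily trigonalizable and the exterior power is multiplicative
   (Cauchy-Binet), so det(1 - L^k A) is the product of the 1 - x_S over the k-subsets S of the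
   eigenvalues x_1, ..., x_6.  When x_1 ... x_6 = 1, put q = c5 - c1, r = c4 - c2 and
   e = f(1) = 2 + c1 + ... + c5.  The product over the pairs is a polynomial D in the c_i, and
   the product over the triples is the square of a polynomial E, because complementary triples
   have inverse products.  Once c3 is eliminated through e = 1 or e = -1, D and E become
     D = q (r + 2q) (c1 (r - 2q) - q c2) + (a polynomial in e, q, r equal to e q^3 at r = -2q),
     E = - e c1^2 + (an affine polynomial in c1 and c2, with coefficients depending on e, q, r),
   so that D = +-1 forces r + 2q to divide e q^3 -+ 1.  For q >= 2 this leaves finitely many r;
   for each of them D = +-1 determines c1 (r - 2q) - q c2, and E = +-1 is a quadratic equation
   for c1 with leading coefficient - e q.  For q = 0 one gets r = +-1 and E is linear in c2.
   For q = 1 the exceptional cases r = -2 and c2 = c1 (r - 2) - r^2 + 2r - 2 give the families: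
   in the second one E is a quadratic polynomial in c1 - 2r. *)

Require Import Defs.
From Stdlib Require Import ZArith.
From mathcomp Require Import all_boot all_order all_algebra all_fingroup all_field.
From mathcomp Require Import reals ring lra zify ssrZ.

Set Implicit Arguments.
Unset Strict Implicit.
Unset Printing Implicit Defensive.

Import Order.TTheory GRing.Theory Num.Theory.

Local Open Scope ring_scope.

(** * Exterior powers *)

Lemma incr_mapsP (k n : nat) (S : {ffun 'I_k -> 'I_n}) :
  reflect {homo S : i j / (i < j)%N} (S \in incr_maps k n).
Proof.
rewrite inE; apply: (iffP forallP) => [h i j lt_ij | h i].
  by move/forallP/(_ j)/implyP: (h i); apply.
by apply/forallP => j; apply/implyP/h.
Qed.

Lemma incr_inj (k n : nat) (S : {ffun 'I_k -> 'I_n}) :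
  S \in incr_maps k n -> injective S.
Proof.
move=> /incr_mapsP h i j eS; apply/val_inj/eqP; rewrite eqn_leq.
by apply/andP; split; rewrite leqNgt; apply/negP => /h; rewrite eS ltnn.
Qed.

Lemma incr_ge_id (k : nat) (t : 'I_k -> 'I_k) :
  {homo t : i j / (i < j)%N} -> forall i : 'I_k, (i <= t i)%N.
Proof.
move=> h [m]; elim: m => [|m IHm] //= lt_mk.
by apply: leq_ltn_trans (IHm (ltnW lt_mk)) _; apply: h.
Qed.

(** Both [s] and its inverse are increasing, hence pointwise at least the identity, which forces
    [s = 1]. *)
Lemma incr_comp_perm (k n : nat) (S U : {ffun 'I_k -> 'I_n}) (s : 'S_k) :
  S \in incr_maps k n -> U \in incr_maps k n -> (forall i, S i = U (s i)) ->
  S = U /\ s = 1%g.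
Proof.
move=> hS hU eSU.
have hh (V W : {ffun 'I_k -> 'I_n}) (t : 'S_k) : V \in incr_maps k n ->
    W \in incr_maps k n -> (forall i, V i = W (t i)) -> {homo t : i j / (i < j)%N}.
  move=> /incr_mapsP hV hW eVW i j lt_ij; have := hV _ _ lt_ij; rewrite !eVW.
  case: (ltngtP (t i) (t j)) => // [lt_ji|/val_inj->]; last by rewrite ltnn.
  by move/incr_mapsP: hW => /(_ _ _ lt_ji) /ltnW; rewrite leqNgt => /negPf->.
have s1 : s = 1%g.
  apply/permP => i; rewrite perm1; apply/val_inj/eqP; rewrite eqn_leq.
  rewrite (incr_ge_id (hh _ _ _ hS hU eSU)) andbT.
  have eUS j : U j = S (s^-1 j)%g by rewrite eSU permKV.
  by rewrite -[X in (_ <= nat_of_ord X)%N](permK s) (incr_ge_id (hh _ _ _ hU hS eUS)).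
by split=> //; apply/ffunP => i; rewrite eSU s1 perm1.
Qed.

(** [U] lists the image of [f] in increasing order. With [incr_comp_perm] this makes the
    factorization exist and be unique. *)
Lemma incr_sort (k n : nat) (f : {ffun 'I_k -> 'I_n}) : injective f ->
  exists2 U, U \in incr_maps k n & exists s : 'S_k, f = [ffun i => U (s i)].
Proof.
move=> f_inj; pose D := f @: setT.
have cD : #|D| = k by rewrite card_imset // cardsT card_ord.
have fD i : f i \in D by rewrite imset_f ?inE.
pose U := [ffun i : 'I_k => enum_val (cast_ord (esym cD) i)].
pose g i := cast_ord cD (enum_rank_in (fD i) (f i)).
have Ug i : U (g i) = f i by rewrite ffunE cast_ordK enum_rankK_in.
have g_inj : injective g by move=> i j eg; apply: f_inj; rewrite -!Ug eg.
exists U; last by exists (perm g_inj); apply/ffunP => i; rewrite ffunE permE Ug.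
apply/incr_mapsP => i j lt_ij; rewrite !ffunE.
have x0 : 'I_n := enum_val (cast_ord (esym cD) i).
rewrite !(enum_val_nth x0) /=.
have sD : sorted (fun x y : 'I_n => (x < y)%N) (enum D).
  rewrite sorted_filter //; first by move=> x y z; apply: ltn_trans.
  have := iota_ltn_sorted 0 n; rewrite -val_enum_ord sorted_map enumT; exact: id.
apply: (sorted_ltn_nth _ x0 sD) => //; first by move=> x y z; apply: ltn_trans.
- by rewrite inE -cardE cD.
- by rewrite inE -cardE cD.
Qed.

(** Expanding the product gives a sum over all maps [f]. A non-injective [f] repeats a row of [B]
    and contributes 0. An injective one is uniquely an increasing map composed with a permutation,
    and summing over the permutations rebuilds the minor of [A]. *)
Lemma cauchy_binet (R : comNzRingType) (k n : nat)
    (A : 'M[R]_(k, n)) (B : 'M[R]_(n, k)) :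
  \det (A *m B)
    = \sum_(U in incr_maps k n) \det (colsub U A) * \det (rowsub U B).
Proof.
pose F (f : {ffun 'I_k -> 'I_n}) := (\prod_i A i (f i)) * \det (rowsub f B).
have -> : \det (A *m B) = \sum_f F f.
  rewrite /F /determinant.
  under [RHS]eq_bigr do rewrite mulr_sumr.
  rewrite exchange_big; apply: eq_bigr => s _ /=.
  under eq_bigr do rewrite mxE.
  rewrite bigA_distr_bigA mulr_sumr; apply: eq_bigr => f _.
  rewrite mulrCA -big_split; congr (_ * _); apply: eq_bigr => i _.
  by rewrite !mxE.
have F0 (f : {ffun 'I_k -> 'I_n}) : ~~ injectiveb f -> F f = 0.
  move=> /injectivePn [i [j neq_ij eq_f]].
  rewrite /F (determinant_alternate neq_ij) ?mulr0 // => l.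
  by rewrite !mxE eq_f.
rewrite (bigID (fun f : {ffun 'I_k -> 'I_n} => injectiveb f)) /=.
rewrite addrC big1 ?add0r; last by move=> f; apply: F0.
pose h (p : {ffun 'I_k -> 'I_n} * 'S_k) : {ffun 'I_k -> 'I_n} :=
  [ffun i => p.1 (p.2 i)].
pose Q (f : {ffun 'I_k -> 'I_n}) (p : {ffun 'I_k -> 'I_n} * 'S_k) :=
  (p.1 \in incr_maps k n) && (f == h p).
(* The default is returned only for non-injective [f], already removed from the sum. *)
pose h' f := odflt (f, 1%g) [pick p | Q f p].
have h'P (f : {ffun 'I_k -> 'I_n}) : injective f -> Q f (h' f).
  move=> f_inj; rewrite /h'; case: pickP => //= noQ.
  have [U hU [s ef]] := incr_sort f_inj.
  by have := noQ (U, s); rewrite /Q /= hU ef eqxx.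
rewrite (reindex_onto h h') /=; last first.
  by move=> f /injectiveP/h'P /andP[_ /eqP].
transitivity (\sum_(U in incr_maps k n) \sum_(s : 'S_k) F (h (U, s))).
  rewrite pair_big /=; apply: eq_big => -[U s] //=; rewrite andbT.
  apply/andP/idP => [[/injectiveP/h'P/andP[hU _] /eqP eh]|hU].
    by move: hU; rewrite eh.
  have inj_h : injective (h (U, s)).
    by move=> i j; rewrite !ffunE => /(incr_inj hU)/perm_inj.
  split; first exact/injectiveP.
  have := h'P _ inj_h; case: (h' _) => U' s' /andP[/= hU' /eqP eh].
  have [] := incr_comp_perm (s := (s^-1 * s')%g) hU hU'.
    by move=> i; have /ffunP/(_ (s^-1 i)%g) := eh; rewrite !ffunE /= permKV permM.
  by move=> -> /(congr1 (mulg s)); rewrite mulKVg mulg1 => ->.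
apply: eq_bigr => U _; rewrite /F mulr_suml; apply: eq_bigr => s _.
have -> : rowsub (h (U, s)) B = row_perm s (rowsub U B).
  by apply/matrixP => i j; rewrite !mxE ffunE.
rewrite row_permE det_mulmx det_perm mulrCA mulrA; congr (_ * _ * _).
by apply: eq_bigr => i _; rewrite mxE ffunE.
Qed.

Lemma ext_powerM (R : comNzRingType) (n k : nat) (A B : 'M[R]_n) :
  ext_power k (A *m B) = ext_power k A *m ext_power k B.
Proof.
apply/matrixP => i j; rewrite !mxE.
set S : {ffun 'I_k -> 'I_n} := enum_val i; set T : {ffun 'I_k -> 'I_n} := enum_val j.
transitivity (\det (rowsub S A *m colsub T B)).
  by congr (\det _); apply/matrixP => x y; rewrite !mxE; apply: eq_bigr => l _; rewrite !mxE.
rewrite cauchy_binet -/S -/T.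
rewrite (big_enum_val (fun U : {ffun 'I_k -> 'I_n} =>
  \det (colsub U (rowsub S A)) * \det (rowsub U (colsub T B)))) /=.
apply: eq_bigr => l _; rewrite !mxE /=.
by congr (_ * _); congr (\det _); apply/matrixP => x y; rewrite !mxE.
Qed.

Lemma det_mxsub_neq0 (R : comNzRingType) (n k : nat) (A : 'M[R]_n)
    (S U : {ffun 'I_k -> 'I_n}) :
  \det (mxsub S U A) != 0 -> exists s : 'S_k, forall i, A (S i) (U (s i)) != 0.
Proof.
move=> nz; suff /existsP[s /forallP h] : [exists s : 'S_k, [forall i, A (S i) (U (s i)) != 0]].
  by exists s.
apply: contraNT nz => /existsPn h; apply/eqP/big1 => s _.
have /forallPn[i /negbNE/eqP Ai0] := h s.
by rewrite (bigD1 i) //= mxE Ai0 mul0r mulr0.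
Qed.

Lemma ext_power1 (R : comNzRingType) (n k : nat) :
  ext_power k (1%:M : 'M[R]_n) = 1%:M.
Proof.
apply/matrixP => i j; rewrite !mxE; case: (i =P j) => [->|neq_ij] /=.
  rewrite -[RHS](det1 R k); congr (\det _); apply/matrixP => x y; rewrite !mxE.
  by rewrite (inj_eq (incr_inj (enum_valP j))).
apply/eqP/negPn/negP => /det_mxsub_neq0[s h].
have [|e _] := incr_comp_perm (s := s) (enum_valP i) (enum_valP j).
  by move=> x; have := h x; rewrite mxE; case: (enum_val i x =P _) => // _; rewrite eqxx.
by apply: neq_ij; apply: enum_val_inj.
Qed.

Lemma map_ext_power (R S : comNzRingType) (f : {rmorphism R -> S}) (n k : nat)
    (A : 'M[R]_n) : map_mx f (ext_power k A) = ext_power k (map_mx f A).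
Proof. by apply/matrixP => i j; rewrite !mxE -det_map_mx map_mxsub. Qed.

(* Nonzero off-diagonal entries of [M] strictly decrease [w], so the identity is the only
   permutation contributing to the Leibniz expansion. *)
Lemma det_weight_trig (R : comNzRingType) (n : nat) (M : 'M[R]_n) (w : 'I_n -> nat) :
  (forall i j, i != j -> M i j != 0 -> (w j < w i)%N) -> \det M = \prod_i M i i.
Proof.
move=> h; rewrite /determinant (bigD1 1%g) //= odd_perm1 mul1r.
rewrite [X in _ + X]big1 ?addr0 => [|s s1]; first by apply: eq_bigr => i _; rewrite perm1.
suff /existsP[i /eqP Mi0] : [exists i, M i (s i) == 0].
  by rewrite (bigD1 i) //= Mi0 mul0r mulr0.
apply: contraNT s1 => /existsPn nz; apply/eqP/permP => i; rewrite perm1.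
apply/eqP; apply: contraTT (leqnn (\sum_j w j)) => neq_i.
rewrite -ltnNge {1}(reindex_inj (@perm_inj _ s)) /=.
rewrite (bigD1 i) //= [X in (_ < X)%N](bigD1 i) //=.
rewrite -addSn leq_add ?h ?nz ?(eq_sym i) //; apply: leq_sum => j _.
by case: (eqVneq j (s j)) => [<- //|neq_j]; apply/ltnW/h.
Qed.

(** Weigh [S] by the sum of its values. As [T] is lower triangular, a nonzero minor at [(S, U)]
    supplies a permutation [s] with [U (s i) <= S i] for all [i], so the weight drops unless
    [S = U], and [det_weight_trig] applies. *)
Lemma det_ext_power_trig (R : comNzRingType) (n k : nat) (T : 'M[R]_n) :
  is_trig_mx T ->
  \det (1%:M - ext_power k T)
    = \prod_(S in incr_maps k n) (1 - \prod_(i < k) T (S i) (S i)).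
Proof.
move=> /is_trig_mxP trT.
have trS (S U : {ffun 'I_k -> 'I_n}) : S \in incr_maps k n -> U \in incr_maps k n ->
    S != U -> \det (mxsub S U T) != 0 -> (\sum_i U i < \sum_i S i)%N.
  move=> hS hU neq_SU /det_mxsub_neq0[s hs].
  have le_i i : (U (s i) <= S i)%N.
    by rewrite leqNgt; apply/negP => /trT e0; move: (hs i); rewrite e0 eqxx.
  rewrite (reindex_inj (@perm_inj _ s)) /=.
  suff /existsP[i neq_i] : [exists i, S i != U (s i)].
    rewrite (bigD1 i) //= [X in (_ < X)%N](bigD1 i) //= -addSn leq_add ?leq_sum //.
    by rewrite ltn_neqAle le_i andbT eq_sym.
  apply: contraNT neq_SU => /existsPn e; apply/eqP.
  by have [|//] := incr_comp_perm (s := s) hS hU; move=> i; apply/eqP/negbNE.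
rewrite (@det_weight_trig _ _ _ (fun i => \sum_x (enum_val i : {ffun 'I_k -> 'I_n}) x)%N).
  rewrite [RHS](big_enum_val (fun S : {ffun 'I_k -> 'I_n} => 1 - \prod_(i < k) T (S i) (S i))) /=.
  apply: eq_bigr => i _; rewrite !mxE eqxx; congr (_ - _).
  rewrite /= det_trig; first by apply: eq_bigr => x _; rewrite mxE.
  apply/is_trig_mxP => x y lt_xy; rewrite mxE trT //.
  by have /incr_mapsP := enum_valP i; apply.
move=> i j neq_ij; rewrite !mxE (negPf neq_ij) sub0r oppr_eq0 /=.
by apply: trS; rewrite ?enum_valP // (inj_eq enum_val_inj).
Qed.

Lemma det_ext_power_similar (R : comUnitRingType) (n k : nat) (P A : 'M[R]_n) :
  P \in unitmx ->
  \det (1%:M - ext_power k (P *m A *m invmx P)) = \det (1%:M - ext_power k A).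
Proof.
move=> Pu; rewrite !ext_powerM.
have PP : ext_power k P *m ext_power k (invmx P) = 1%:M.
  by rewrite -ext_powerM mulmxV // ext_power1.
rewrite -[X in X - _]PP -[in X in X - _](mulmx1 (ext_power k P)) -mulmxBl -mulmxBr.
by rewrite !det_mulmx mulrAC -det_mulmx PP det1 mul1r.
Qed.

(** * Symmetric function identities *)

(** With [e1], ..., [e4] the elementary symmetric functions of four elements, this is the product of
    [1 - t * x_i * x_j] over their six pairs; [pairs_resolvent5] is the analogue for five
    elements. *)
Definition pairs_resolvent4 (R : comNzRingType) (t e1 e2 e3 e4 : R) : R :=
  t ^+ 6 * e4 ^+ 3 - t ^+ 5 * e2 * e4 ^+ 2 + t ^+ 4 * (e1 * e3 * e4 - e4 ^+ 2)
  + t ^+ 3 * (2 * e2 * e4 - e1 ^+ 2 * e4 - e3 ^+ 2) + t ^+ 2 * (e1 * e3 - e4) - t * e2 + 1.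

Definition pairs_resolvent5 (R : comNzRingType) (t e1 e2 e3 e4 e5 : R) : R :=
  t ^+ 10 * e5 ^+ 4 - t ^+ 9 * e3 * e5 ^+ 3 + t ^+ 8 * (e2 * e4 * e5 ^+ 2 - e1 * e5 ^+ 3)
  + t ^+ 7 * (2 * e1 * e3 * e5 ^+ 2 - e1 * e4 ^+ 2 * e5 - e2 ^+ 2 * e5 ^+ 2 + e4 * e5 ^+ 2)
  + t ^+ 6 * (e1 * e2 * e4 * e5 - e1 ^+ 2 * e5 ^+ 2 + e2 * e5 ^+ 2 - 3 * e3 * e4 * e5
              + e4 ^+ 3)
  + t ^+ 5 * (2 * e1 * e4 * e5 + 2 * e2 * e3 * e5 - e1 ^+ 2 * e3 * e5 - e2 * e4 ^+ 2
              - 2 * e5 ^+ 2)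
  + t ^+ 4 * (e1 ^+ 3 * e5 - 3 * e1 * e2 * e5 + e1 * e3 * e4 + e3 * e5 - e4 ^+ 2)
  + t ^+ 3 * (e1 * e5 + 2 * e2 * e4 - e1 ^+ 2 * e4 - e3 ^+ 2) + t ^+ 2 * (e1 * e3 - e4)
  - t * e2 + 1.

Lemma pairs_resolvent4E (R : comNzRingType) (t x0 x1 x2 x3 : R) :
  (1 - t * (x0 * x1)) * (1 - t * (x0 * x2)) * (1 - t * (x0 * x3)) * (1 - t * (x1 * x2))
    * (1 - t * (x1 * x3)) * (1 - t * (x2 * x3))
  = pairs_resolvent4 t (x0 + x1 + x2 + x3)
      (x0 * x1 + x0 * x2 + x0 * x3 + x1 * x2 + x1 * x3 + x2 * x3)
      (x0 * x1 * x2 + x0 * x1 * x3 + x0 * x2 * x3 + x1 * x2 * x3) (x0 * x1 * x2 * x3).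
Proof. by rewrite /pairs_resolvent4; ring. Qed.

(** Adjoining a fifth element [x] adds four pairs; the second factor is the product of the
    [1 - t * x * x_i]. *)
Lemma pairs_resolvent5S (R : comNzRingType) (t x s1 s2 s3 s4 : R) :
  pairs_resolvent4 t s1 s2 s3 s4
    * (1 - t * x * s1 + t ^+ 2 * x ^+ 2 * s2 - t ^+ 3 * x ^+ 3 * s3 + t ^+ 4 * x ^+ 4 * s4)
  = pairs_resolvent5 t (s1 + x) (s2 + x * s1) (s3 + x * s2) (s4 + x * s3) (x * s4).
Proof. by rewrite /pairs_resolvent4 /pairs_resolvent5; ring. Qed.

(** This is [D] before [c3] is eliminated, for constant coefficient 1; [triples_form] is likewise
    [E]. *)
Definition pairs_form (R : comNzRingType) (c1 c2 c3 c4 c5 : R) : R :=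
  let q := c5 - c1 in let r := c4 - c2 in
  q ^+ 3 * (c3 - 2 * c1) + q * r ^+ 2 * c1 - q ^+ 2 * r * c2 - q ^+ 4 + 3 * q ^+ 2 * r - r ^+ 3.

Definition triples_form (R : comNzRingType) (c1 c2 c3 c4 c5 : R) : R :=
  - c1 ^+ 3 - c1 ^+ 2 * c4 - c1 * c3 * c5 - c2 * c5 ^+ 2 - c5 ^+ 3 + 4 * c1 * c2 + 2 * c1 * c5
  + 4 * c2 * c4 - c3 ^+ 2 + 4 * c4 * c5 - 4 * c3 - 4.

(* The arguments on the right are the coefficients of (X - x) (X^5 - s1 X^4 + ... - s5). *)
Lemma pairs_formE (F : fieldType) (x s1 s2 s3 s4 s5 : F) : x != 0 -> x * s5 = 1 ->
  pairs_resolvent5 1 s1 s2 s3 s4 s5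
    * (1 - x * s1 + x ^+ 2 * s2 - x ^+ 3 * s3 + x ^+ 4 * s4 - x ^+ 5 * s5)
  = pairs_form (- (s5 + x * s4)) (s4 + x * s3) (- (s3 + x * s2)) (s2 + x * s1) (- (s1 + x)).
Proof.
by move=> x0 /(canRL (mulKf x0)) ->; rewrite /pairs_resolvent5 /pairs_form; field.
Qed.

(** Taking [t = x] turns the pairs of the five other elements into the ten triples that contain
    [x]. *)
Lemma triples_formE (F : fieldType) (x s1 s2 s3 s4 s5 : F) : x != 0 -> x * s5 = 1 ->
  pairs_resolvent5 x s1 s2 s3 s4 s5
  = x ^+ 3 * triples_form (- (s5 + x * s4)) (s4 + x * s3) (- (s3 + x * s2)) (s2 + x * s1)
               (- (s1 + x)).
Proof.
by move=> x0 /(canRL (mulKf x0)) ->; rewrite /pairs_resolvent5 /triples_form; field.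
Qed.

(** * Products over 1-, 2- and 3-subsets as iterated products *)

Lemma big_incr_maps1 (R : comNzRingType) (n : nat) (x : nat -> R) :
  \prod_(S in incr_maps 1 n) (1 - \prod_(i < 1) x (S i)) = \prod_(0 <= i < n) (1 - x i).
Proof.
rewrite big_mkord.
rewrite (reindex (fun i : 'I_n => [ffun _ : 'I_1 => i])) /=; last first.
  exists (fun S : {ffun 'I_1 -> 'I_n} => S ord0) => [i _|S _]; first by rewrite ffunE.
  by apply/ffunP => i; rewrite ffunE (ord1 i).
apply: eq_big => [i|i _]; last by rewrite big_ord1 ffunE.
by apply/incr_mapsP => a b; rewrite !ord1.
Qed.

Lemma big_incr_maps2 (R : comNzRingType) (n : nat) (x : nat -> R) :
  \prod_(S in incr_maps 2 n) (1 - \prod_(i < 2) x (S i))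
    = \prod_(0 <= i < n) \prod_(i.+1 <= j < n) (1 - x i * x j).
Proof.
rewrite big_mkord; under [RHS]eq_bigr do rewrite big_geq_mkord.
rewrite pair_big_dep /=.
pose h (p : 'I_n * 'I_n) : {ffun 'I_2 -> 'I_n} := [ffun a : 'I_2 => nth p.1 [:: p.1; p.2] a].
rewrite (reindex h) /=; last first.
  exists (fun S : {ffun 'I_2 -> 'I_n} => (S ord0, S ord_max)) => [[i j] _|S _].
    by rewrite !ffunE.
  by apply/ffunP => -[[|[|//]] lt_a]; rewrite ffunE; congr (S _); apply: val_inj.
apply: eq_big => [[i j]|[i j] _] /=.
  apply/incr_mapsP/idP => [/(_ ord0 ord_max isT)|lt_ij]; first by rewrite !ffunE.
  by move=> [[|[|//]] ?] [[|[|//]] ?] //= _; rewrite !ffunE.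
by rewrite !big_ord_recl big_ord0 !ffunE mulr1.
Qed.

Lemma big_incr_maps3 (R : comNzRingType) (n : nat) (x : nat -> R) :
  \prod_(S in incr_maps 3 n) (1 - \prod_(i < 3) x (S i))
    = \prod_(0 <= i < n) \prod_(i.+1 <= j < n) \prod_(j.+1 <= k < n)
        (1 - x i * x j * x k).
Proof.
rewrite big_mkord; under [RHS]eq_bigr => i _.
  by rewrite big_geq_mkord; under eq_bigr do rewrite big_geq_mkord; over.
under [RHS]eq_bigr do rewrite pair_big_dep /=.
rewrite pair_big_dep /=.
pose h (p : 'I_n * ('I_n * 'I_n)) : {ffun 'I_3 -> 'I_n} :=
  [ffun a : 'I_3 => nth p.1 [:: p.1; p.2.1; p.2.2] a].
rewrite (reindex h) /=; last first.
  exists (fun S : {ffun 'I_3 -> 'I_n} => (S ord0, (S (lift ord0 ord0), S ord_max))).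
    by move=> [i [j k]] _; rewrite !ffunE.
  by move=> S _; apply/ffunP => -[[|[|[|//]]] lt_a]; rewrite ffunE; congr (S _); apply: val_inj.
apply: eq_big => [[i [j k]]|[i [j k]] _] /=.
  apply/incr_mapsP/andP => [hS|[lt_ij lt_jk]].
    have := hS ord0 (lift ord0 ord0) isT; have := hS (lift ord0 ord0) ord_max isT.
    by rewrite !ffunE.
  move=> [[|[|[|//]]] ?] [[|[|[|//]]] ?] //= _; rewrite !ffunE //=.
  exact: ltn_trans lt_jk.
by rewrite !big_ord_recl big_ord0 !ffunE mulr1 mulrA.
Qed.

Definition esym5 (R : nzRingType) (y : nat -> R) (k : nat) : R :=
  let x0 := y 0%N in let x1 := y 1%N in let x2 := y 2%N in let x3 := y 3%N in
  let x4 := y 4%N in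
  match k with
  | 1%N => x0 + x1 + x2 + x3 + x4
  | 2%N => x0 * x1 + x0 * x2 + x0 * x3 + x0 * x4 + x1 * x2 + x1 * x3 + x1 * x4 + x2 * x3
           + x2 * x4 + x3 * x4
  | 3%N => x0 * x1 * x2 + x0 * x1 * x3 + x0 * x1 * x4 + x0 * x2 * x3 + x0 * x2 * x4
           + x0 * x3 * x4 + x1 * x2 * x3 + x1 * x2 * x4 + x1 * x3 * x4 + x2 * x3 * x4
  | 4%N => x0 * x1 * x2 * x3 + x0 * x1 * x2 * x4 + x0 * x1 * x3 * x4 + x0 * x2 * x3 * x4
           + x1 * x2 * x3 * x4
  | _ => x0 * x1 * x2 * x3 * x4
  end.

Lemma prod_XsubC6 (R : comNzRingType) (y : nat -> R) (s := esym5 y) :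
  \prod_(i < 6) ('X - (y i)%:P)
    = 'X^6 + (- (s 1%N + y 5%N)) *: 'X^5 + (s 2%N + y 5%N * s 1%N) *: 'X^4
      + (- (s 3%N + y 5%N * s 2%N)) *: 'X^3 + (s 4%N + y 5%N * s 3%N) *: 'X^2
      + (- (s 5%N + y 5%N * s 4%N)) *: 'X + (y 5%N * s 5%N)%:P.
Proof.
by rewrite !big_ord_recr big_ord0 /= -!mul_polyC /s /esym5; ring.
Qed.

Lemma prod_pairs5 (R : comNzRingType) (t : R) (y : nat -> R) (s := esym5 y) :
  \prod_(0 <= i < 5) \prod_(i.+1 <= j < 5) (1 - t * (y i * y j))
    = pairs_resolvent5 t (s 1%N) (s 2%N) (s 3%N) (s 4%N) (s 5%N).
Proof.
pose x0 := y 0%N; pose x1 := y 1%N; pose x2 := y 2%N; pose x3 := y 3%N.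
pose e1 := x0 + x1 + x2 + x3.
pose e2 := x0 * x1 + x0 * x2 + x0 * x3 + x1 * x2 + x1 * x3 + x2 * x3.
pose e3 := x0 * x1 * x2 + x0 * x1 * x3 + x0 * x2 * x3 + x1 * x2 * x3.
pose e4 := x0 * x1 * x2 * x3.
have -> : s 1%N = e1 + y 4%N by [].
have -> : s 2%N = e2 + y 4%N * e1 by rewrite /s /esym5 /e2 /e1 /x0 /x1 /x2 /x3; ring.
have -> : s 3%N = e3 + y 4%N * e2 by rewrite /s /esym5 /e3 /e2 /x0 /x1 /x2 /x3; ring.
have -> : s 4%N = e4 + y 4%N * e3 by rewrite /s /esym5 /e4 /e3 /x0 /x1 /x2 /x3; ring.
have -> : s 5%N = y 4%N * e4 by rewrite /s /esym5 /e4 /x0 /x1 /x2 /x3; ring.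
rewrite -pairs_resolvent5S -pairs_resolvent4E unlock /= /e1 /e2 /e3 /e4 /x0 /x1 /x2 /x3.
by ring.
Qed.

(** The ten pairs avoiding [x] give [pairs_resolvent5 1], the five pairs containing [x] give the
    product of the [1 - y i * x], and [pairs_formE] joins the two. *)
Lemma prod_pairs6 (F : fieldType) (y : nat -> F) (s := esym5 y) (x := y 5%N) :
  x * s 5%N = 1 ->
  \prod_(0 <= i < 6) \prod_(i.+1 <= j < 6) (1 - y i * y j)
    = pairs_form (- (s 5%N + x * s 4%N)) (s 4%N + x * s 3%N) (- (s 3%N + x * s 2%N))
        (s 2%N + x * s 1%N) (- (s 1%N + x)).
Proof.
move=> xs5; have x0 : x != 0 by apply: contra_eq_neq xs5 => ->; rewrite mul0r eq_sym oner_eq0.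
rewrite -pairs_formE // -prod_pairs5.
have -> : 1 - x * s 1%N + x ^+ 2 * s 2%N - x ^+ 3 * s 3%N + x ^+ 4 * s 4%N - x ^+ 5 * s 5%N
   = \prod_(0 <= i < 5) (1 - y i * x).
  by rewrite unlock /= /s /esym5; ring.
rewrite big_nat_recr //= [X in _ * X]big_geq // mulr1 -big_split /= big_nat [RHS]big_nat.
apply: eq_bigr => i /= lt_i5; rewrite big_nat_recr //=.
by congr (_ * _); apply: eq_bigr => j _; rewrite mul1r.
Qed.

(** If a triple has product [u], its complement has product [1 / u], and
    [1 - u = - u * (1 - 1 / u)]. So the ten triples without [x] reproduce the ten with [x] up to the
    product of the [- u]: the ten signs cancel and each of the five variables lies in six triples,
    whence [s 5 ^+ 6]. *)
Lemma prod_triples6 (F : fieldType) (y : nat -> F) (s := esym5 y) (x := y 5%N) :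
  x * s 5%N = 1 ->
  \prod_(0 <= i < 6) \prod_(i.+1 <= j < 6) \prod_(j.+1 <= k < 6) (1 - y i * y j * y k)
    = triples_form (- (s 5%N + x * s 4%N)) (s 4%N + x * s 3%N) (- (s 3%N + x * s 2%N))
        (s 2%N + x * s 1%N) (- (s 1%N + x)) ^+ 2.
Proof.
move=> xs5; have x0 : x != 0 by apply: contra_eq_neq xs5 => ->; rewrite mul0r eq_sym oner_eq0.
have e := etrans (prod_pairs5 x y) (triples_formE _ _ _ _ x0 xs5).
transitivity ((s 5%N) ^+ 6 * (\prod_(0 <= i < 5) \prod_(i.+1 <= j < 5) (1 - x * (y i * y j))) ^+ 2).
  rewrite unlock /= !mulr1.
  move: xs5; rewrite /s /esym5 /x => {x0 e s x}.
  move: (y 5%N) (y 0%N) (y 1%N) (y 2%N) (y 3%N) (y 4%N) => x a b c d f xs5.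
  (* the complement of a triple has the inverse product *)
  have h u v w z t : x * (a * b * c * d * f) = u * v * w * (x * (z * t)) ->
      1 - u * v * w = - (u * v * w) * (1 - x * (z * t)).
    by rewrite xs5 => e; rewrite mulrBr mulNr mulNr -e mulr1 opprK addrC.
  rewrite (h a b c d f) ?(h a b d c f) ?(h a b f c d) ?(h a c d b f) ?(h a c f b d);
    try by ring.
  rewrite (h a d f b c) ?(h b c d a f) ?(h b c f a d) ?(h b d f a c) ?(h c d f a b);
    by ring.
rewrite e; set T := triples_form _ _ _ _ _.
have -> : s 5%N ^+ 6 * (x ^+ 3 * T) ^+ 2 = (x * s 5%N) ^+ 6 * T ^+ 2 by ring.
by rewrite xs5 expr1n mul1r.
Qed.

Lemma rmorph_pairs_form (R S : comNzRingType) (f : {rmorphism R -> S}) (c1 c2 c3 c4 c5 : R) :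
  f (pairs_form c1 c2 c3 c4 c5) = pairs_form (f c1) (f c2) (f c3) (f c4) (f c5).
Proof. by rewrite /pairs_form; ring. Qed.

Lemma rmorph_triples_form (R S : comNzRingType) (f : {rmorphism R -> S}) (c1 c2 c3 c4 c5 : R) :
  f (triples_form c1 c2 c3 c4 c5) = triples_form (f c1) (f c2) (f c3) (f c4) (f c5).
Proof. by rewrite /triples_form; ring. Qed.

Lemma char_poly_similar (R : comUnitRingType) (n : nat) (P A : 'M[R]_n) :
  P \in unitmx -> char_poly (P *m A *m invmx P) = char_poly A.
Proof.
move=> Pu; pose PC := map_mx polyC P; pose QC := map_mx polyC (invmx P).
have PQ : PC *m QC = 1%:M by rewrite -map_mxM mulmxV // map_mx1.
rewrite /char_poly.
have -> : char_poly_mx (P *m A *m invmx P) = PC *m char_poly_mx A *m QC.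
  rewrite /char_poly_mx !map_mxM /= mulmxBr mulmxBl; congr (_ - _).
  by rewrite scalar_mxC -mulmxA PQ mulmx1.
by rewrite !det_mulmx mulrAC -det_mulmx PQ det1 mul1r.
Qed.

(** * Cappell-Shaneson polynomials of degree 6 *)

Lemma det_ext_power_closed (C : numClosedFieldType) (A : 'M[C]_6) (c1 c2 c3 c4 c5 : C) :
  char_poly A = 'X^6 + c5 *: 'X^5 + c4 *: 'X^4 + c3 *: 'X^3 + c2 *: 'X^2 + c1 *: 'X + 1 ->
  [/\ \det (1%:M - ext_power 1 A) = 2 + c1 + c2 + c3 + c4 + c5,
      \det (1%:M - ext_power 2 A) = pairs_form c1 c2 c3 c4 c5
    & \det (1%:M - ext_power 3 A) = triples_form c1 c2 c3 c4 c5 ^+ 2].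
Proof.
have [//|P /unitarymx_unit Pu] := @Schur _ 6 A.
rewrite /similar_to conjumx //; set T := P *m A *m invmx P => trT.
rewrite -(char_poly_similar A Pu) -!(det_ext_power_similar _ A Pu) -/T.
(* [inord] extends the diagonal to a sequence indexed by [nat], the form used in [big_incr_maps1]
   and its variants. *)
pose y m := T (inord m) (inord m).
have Ty (i : 'I_6) : T i i = y i by rewrite /y inord_val.
rewrite char_poly_trig // (eq_bigr (fun i : 'I_6 => 'X - (y i)%:P)) => [|i _]; last by rewrite Ty.
rewrite prod_XsubC6 => /polyP eqf.
move: (eqf 0%N) (eqf 1%N) (eqf 2%N) (eqf 3%N) (eqf 4%N) (eqf 5%N).
rewrite !(coefD, coefZ, coefXn, coefX, coefC, coef1) /=.
rewrite !(mulr0, mulr1, add0r, addr0) => e0 <- <- <- <- <-.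
have E k : \det (1%:M - ext_power k T)
    = \prod_(S in incr_maps k 6) (1 - \prod_(i < k) y (S i)).
  rewrite det_ext_power_trig //; apply: eq_bigr => S _; congr (1 - _).
  by apply: eq_bigr => i _; rewrite Ty.
rewrite !E big_incr_maps1 big_incr_maps2 big_incr_maps3 prod_pairs6 // prod_triples6 //.
split=> //; rewrite unlock /=.
(* The 2 in [f(1)] is the leading coefficient plus the constant one; keeping the latter as the
   product of the eigenvalues leaves a polynomial identity. *)
transitivity (1 + y 5%N * esym5 y 5 + (- (esym5 y 5 + y 5%N * esym5 y 4))
  + (esym5 y 4 + y 5%N * esym5 y 3) + (- (esym5 y 3 + y 5%N * esym5 y 2))
  + (esym5 y 2 + y 5%N * esym5 y 1) + (- (esym5 y 1 + y 5%N))); last by rewrite e0.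
by rewrite /esym5; ring.
Qed.

Lemma det_ext_power_int (A : 'M[int]_6) (c1 c2 c3 c4 c5 : int) :
  char_poly A = 'X^6 + c5 *: 'X^5 + c4 *: 'X^4 + c3 *: 'X^3 + c2 *: 'X^2 + c1 *: 'X + 1 ->
  [/\ \det (1%:M - ext_power 1 A) = 2 + c1 + c2 + c3 + c4 + c5,
      \det (1%:M - ext_power 2 A) = pairs_form c1 c2 c3 c4 c5
    & \det (1%:M - ext_power 3 A) = triples_form c1 c2 c3 c4 c5 ^+ 2].
Proof.
move=> /(congr1 (map_poly (intr : int -> algC))).
rewrite map_char_poly !rmorphD /= !linearZ /= !map_polyXn map_polyX rmorph1.
move=> /det_ext_power_closed.
have m k : \det (1%:M - ext_power k (map_mx (intr : int -> algC) A))
    = (\det (1%:M - ext_power k A))%:~R.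
  by rewrite -det_map_mx map_mxB map_mx1 map_ext_power.
rewrite !m => -[e1 e2 e3]; split; apply: (@intr_inj algC).
- by rewrite e1 !rmorphD.
- by rewrite e2 rmorph_pairs_form.
- by rewrite e3 rmorphXn /= rmorph_triples_form.
Qed.

Lemma exists_char_poly (R : comNzRingType) (n : nat) (f : {poly R}) :
  f \is monic -> size f = n.+1 -> exists A : 'M[R]_n, char_poly A = f.
Proof.
move=> monf szf; have <- : (size f).-1 = n by rewrite szf.
by exists (companionmx f); apply: companionmxK.
Qed.

(** The determinants depend only on the characteristic polynomial, so the companion matrix settles
    the converse; the degree being even, [c0] is the determinant. *)
Lemma cappell_shaneson_poly6P (c0 c1 c2 c3 c4 c5 : int) (f : {poly int})
    (pm1 := fun x : int => x = 1 \/ x = -1) :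
  f = 'X^6 + c5 *: 'X^5 + c4 *: 'X^4 + c3 *: 'X^3 + c2 *: 'X^2 + c1 *: 'X + c0%:P ->
  cappell_shaneson_poly 6 f <->
  c0 = 1 /\ [/\ pm1 (2 + c1 + c2 + c3 + c4 + c5), pm1 (pairs_form c1 c2 c3 c4 c5)
    & pm1 (triples_form c1 c2 c3 c4 c5)].
Proof.
move=> ef; have f0 : f`_0 = c0.
  by rewrite ef !(coefD, coefZ, coefXn, coefX, coefC) /= !mulr0 !add0r.
split=> [[A [_ detA extA] fA]|[c01 [h1 h2 h3]]].
  have c01 : c0 = 1 by rewrite -f0 -fA char_poly_det detA mulr1 -signr_odd expr0.
  rewrite {}c01 {f0} in ef *; split=> //.
  have [e1 e2 e3] := det_ext_power_int (etrans fA ef).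
  rewrite /pm1 -e1 -e2; split; [exact: (extA 1%N)|exact: (extA 2%N)|].
  by move: (extA 3%N isT); rewrite e3 expr2; nia.
rewrite {}c01 {f0} in ef.
have eP : f = Poly [:: 1; c1; c2; c3; c4; c5; 1].
  by rewrite ef /= !cons_poly_def -!mul_polyC; ring.
have sP : f = [:: 1; c1; c2; c3; c4; c5; 1] :> seq int by rewrite eP (PolyK (c := 0)).
have [||A fA] := @exists_char_poly _ 6 f; first by rewrite monicE /lead_coef sP.
  by rewrite sP.
have [e1 e2 e3] := det_ext_power_int (etrans fA ef).
exists A => //; split=> // [|[|[|[|[|k]]]]] //.
- by have := char_poly_det A; rewrite fA sP /= -signr_odd expr0 mul1r.
- by rewrite e1.
- by rewrite e2.
- by rewrite e3; case: h3 => ->; left.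
Qed.

(** * The Diophantine system *)

Section Search.
Local Open Scope Z_scope.

Definition pairsZ (e q r c1 c2 : Z) : Z :=
  (q * (r + 2 * q) * (c1 * (r - 2 * q) - q * c2)
   + (- 2 * q ^ 4 + (e - 2) * q ^ 3 - q ^ 3 * r + 3 * q ^ 2 * r - r ^ 3)).

(** Simplified with [e ^ 2 = 1], hence the hypothesis on [e] in [triplesZE]. *)
Definition triplesZ (e q r c1 c2 : Z) : Z :=
  (- e * c1 ^ 2 - e * c1 * q - 2 * c1 * q ^ 2 + c1 * q * r - c2 * q ^ 2 - q ^ 3 - 1
   + 4 * e * (c1 + c2) + 2 * e * (q + r) - (q - r) ^ 2).

(** The parameter is fixed to 0: entries with [q >= 2] do not depend on it, and for [q = 1]
    membership still exhibits a witness. *)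
Definition tableZ (q : nat) : seq (Z * Z * Z * Z * Z) :=
  [seq (let: (c1, c2, c3, c4, c5, _) := t in
        (Z_of_int c1, Z_of_int c2, Z_of_int c3, Z_of_int c4, Z_of_int c5))
  | t <- cs_table q 0%R].

(** Both equations are tested again, so spurious candidates from rounded square roots or quotients
    are harmless. *)
Definition candidate_ok (T : seq (Z * Z * Z * Z * Z)) (e q r d h c1 c2 : Z) : bool :=
  ((pairsZ e q r c1 c2 =? d) && (triplesZ e q r c1 c2 =? h)) ==>
  ((c1, c2, e - 2 - 2 * c1 - q - 2 * c2 - r, c2 + r, c1 + q) \in T).

Definition roots_ok (T : seq (Z * Z * Z * Z * Z)) (e q r d h w : Z) : bool :=
  let al := - e * q in
  let be := - e * q ^ 2 - 2 * q ^ 3 + q ^ 2 * r - (q ^ 2 - 4 * e) * (r - 2 * q) + 4 * e * q in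
  let ga := (q ^ 2 - 4 * e) * w + q * (- q ^ 3 - 1 + 2 * e * (q + r) - (q - r) ^ 2 - h) in
  let s := Z.sqrt (be ^ 2 - 4 * al * ga) in
  let ok c1 := candidate_ok T e q r d h c1 ((c1 * (r - 2 * q) - w) / q) in
  ok ((s - be) / (2 * al)) && ok ((- s - be) / (2 * al)).

(* [pairsZ = d] determines [w = c1 (r - 2 q) - q c2] from [u = r + 2 q != 0], and eliminating
   [c2] from [triplesZ = h] leaves [al c1^2 + be c1 + ga = 0] with [al = - e q]. *)
Definition search_ok (T : seq (Z * Z * Z * Z * Z)) (q e d h u : Z) : bool :=
  let r := u - 2 * q in
  let k := d - (- 2 * q ^ 4 + (e - 2) * q ^ 3 - q ^ 3 * r + 3 * q ^ 2 * r - r ^ 3) in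
  if k mod (q * u) =? 0 then roots_ok T e q r d h (k / (q * u)) else true.

(** The discriminant is the square of [2 * al * c1 + be], so [Z.sqrt] is exact and a solution [c1]
    is one of the two candidates, according to the sign of that number. *)
Lemma roots_okP (T : seq (Z * Z * Z * Z * Z)) (e q r d h c1 c2 : Z)
    (w := c1 * (r - 2 * q) - q * c2) :
  q <> 0 -> e <> 0 -> roots_ok T e q r d h w -> triplesZ e q r c1 c2 = h ->
  candidate_ok T e q r d h c1 c2.
Proof.
move=> q0 e0 hok ht; move: hok; rewrite /roots_ok.
set al := - e * q; set be := _ + 4 * e * q; set ga := _ + q * (_ - h).
have quad : al * c1 ^ 2 + be * c1 + ga = 0.
  by rewrite /al /be /ga -ht /triplesZ /w; ring.
have eD : be ^ 2 - 4 * al * ga = Z.abs (2 * al * c1 + be) * Z.abs (2 * al * c1 + be).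
  rewrite -Z.abs_mul Z.abs_eq; last by apply: Z.square_nonneg.
  have -> : ga = - (al * c1 ^ 2 + be * c1) by lia.
  by ring.
rewrite eD Z.sqrt_square; last by apply: Z.abs_nonneg.
have al0 : 2 * al <> 0.
  by have /Z.neq_mul_0 : e <> 0 /\ q <> 0 by []; rewrite /al; clear; lia.
have ec1 : (2 * al * c1 + be - be) / (2 * al) = c1.
  by rewrite (_ : _ - be = c1 * (2 * al)) ?Z.div_mul //; ring.
have ec2 : (c1 * (r - 2 * q) - w) / q = c2.
  by rewrite (_ : _ - w = c2 * q) ?Z.div_mul // /w; ring.
case/andP; have [/Z.abs_eq->|/Z.abs_neq->] := Z.le_ge_cases 0 (2 * al * c1 + be).
  by rewrite ec1 ec2.
by move=> _; rewrite Z.opp_involutive ec1 ec2.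
Qed.

Lemma search_okP (T : seq (Z * Z * Z * Z * Z)) (q e d h u c1 c2 : Z)
    (r := u - 2 * q) :
  q <> 0 -> e <> 0 -> u <> 0 -> search_ok T q e d h u ->
  pairsZ e q r c1 c2 = d -> triplesZ e q r c1 c2 = h ->
  (c1, c2, e - 2 - 2 * c1 - q - 2 * c2 - r, c2 + r, c1 + q) \in T.
Proof.
move=> q0 e0 u0; rewrite /search_ok -/r => hs hp ht.
have /Z.neq_mul_0 qu0 : q <> 0 /\ u <> 0 by [].
move: hs; rewrite (_ : d - _ = (c1 * (r - 2 * q) - q * c2) * (q * u)); last first.
  by rewrite -hp /pairsZ /r; ring.
rewrite Z.mod_mul // Z.div_mul // Z.eqb_refl => /roots_okP-/(_ q0 e0 ht).
by rewrite /candidate_ok hp ht !Z.eqb_refl.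
Qed.

(** [L] runs over the integers [u] from [- m] to [m], where [m] bounds the nonzero number
    [d - e * q ^ 3] that [u] must divide. *)
Definition full_search (q : nat) : bool :=
  let T := tableZ q in
  let m := Z.of_nat q ^ 3 + 1 in
  let L := [seq Z.of_nat k - m | k <- iota 0 (Z.to_nat (2 * m + 1))] in
  all (fun e => all (fun d => all (fun h => all (search_ok T (Z.of_nat q) e d h) L)
    [:: 1; -1]) [:: 1; -1]) [:: 1; -1].

Lemma full_search_ok (q : nat) : (2 <= q <= 12)%N -> full_search q.
Proof.
have /allP h : all full_search (iota 2 11) by vm_cast_no_check (erefl true).
by move=> /andP[q2 q12]; apply: h; rewrite mem_iota q2 ltnS.
Qed.

Lemma table_complete_ge2 (q : nat) (e r c1 c2 : Z) (Q := Z.of_nat q) :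
  (2 <= q <= 12)%N -> e = 1 \/ e = -1 ->
  pairsZ e Q r c1 c2 = 1 \/ pairsZ e Q r c1 c2 = -1 ->
  triplesZ e Q r c1 c2 = 1 \/ triplesZ e Q r c1 c2 = -1 ->
  (c1, c2, e - 2 - 2 * c1 - Q - 2 * c2 - r, c2 + r, c1 + Q) \in tableZ q.
Proof.
move=> hq he hd hh; have /= := full_search_ok hq.
set d := pairsZ _ _ _ _ _ in hd; set h := triplesZ _ _ _ _ _ in hh.
have pm1 x : x = 1 \/ x = -1 -> x \in [:: 1; -1] by case=> ->.
move=> /allP/(_ _ (pm1 _ he))/allP/(_ _ (pm1 _ hd))/allP/(_ _ (pm1 _ hh))/allP hall.
have /andP[q2 q12] := hq.
have Q2 : 2 <= Q <= 12 by lia.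
have Q3 : 2 ^ 3 <= Q ^ 3 by apply: Z.pow_le_mono_l; lia.
pose u := r + 2 * Q.
(* Since [Q ^ 3 >= 8], the left-hand side is nonzero, so it bounds its divisor [u]. *)
have ed : d - e * Q ^ 3 = u * (Q * (c1 * (r - 2 * Q) - Q * c2) - r ^ 2 + 2 * Q * r - Q ^ 2 - Q ^ 3).
  by rewrite /d /pairsZ /u; ring.
have lt_d : 0 < Z.abs (d - e * Q ^ 3) <= Q ^ 3 + 1.
  by case: he => ->; case: hd => ->; lia.
have u0 : u <> 0 by move=> u0; rewrite u0 Z.mul_0_l in ed; rewrite ed in lt_d; lia.
have le_u : Z.abs u <= Q ^ 3 + 1.
  apply: Z.le_trans (proj2 lt_d); apply: Z.divide_pos_le (proj1 lt_d) _.
  by rewrite ed Z.abs_mul; apply: Z.divide_factor_l.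
have := @search_okP (tableZ q) Q e d h u c1 c2.
rewrite (_ : u - 2 * Q = r); last by rewrite /u; ring.
apply; rewrite // ?/d ?/h //; [by lia|by case: he => ->|].
apply: hall; apply/mapP; exists (Z.to_nat (u + (Q ^ 3 + 1))).
  by rewrite mem_iota add0n; lia.
by lia.
Qed.

End Search.

(** * Completeness of the table *)

Lemma pairsZE (c1 c2 c3 c4 c5 : int) (e := 2 + c1 + c2 + c3 + c4 + c5) :
  pairsZ (Z_of_int e) (Z_of_int (c5 - c1)) (Z_of_int (c4 - c2)) (Z_of_int c1) (Z_of_int c2)
    = Z_of_int (pairs_form c1 c2 c3 c4 c5).
Proof. by rewrite /pairsZ /pairs_form /e; lia. Qed.

Lemma triplesZE (c1 c2 c3 c4 c5 : int) (e := 2 + c1 + c2 + c3 + c4 + c5) :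
  e = 1 \/ e = -1 ->
  triplesZ (Z_of_int e) (Z_of_int (c5 - c1)) (Z_of_int (c4 - c2)) (Z_of_int c1) (Z_of_int c2)
    = Z_of_int (triples_form c1 c2 c3 c4 c5).
Proof.
move=> he; have -> : c3 = e - 2 - c1 - c2 - c4 - c5 by rewrite /e; lia.
by rewrite /triplesZ /triples_form; case: he => ->; lia.
Qed.

Lemma tableZ_mem (q : nat) (c1 c2 c3 c4 c5 : int) :
  (Z_of_int c1, Z_of_int c2, Z_of_int c3, Z_of_int c4, Z_of_int c5) \in tableZ q ->
  exists a p, (c1, c2, c3, c4, c5, p) \in cs_table q a.
Proof.
move=> /mapP[[[[[[d1 d2] d3] d4] d5] p]] ht [] /(can_inj Z_of_intK)->.
do 4!move=> /(can_inj Z_of_intK)->.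
by exists 0, p.
Qed.

(** Selects a row by its position, counted from 0, and a value of the parameter; five equalities of
    coefficients remain. *)
Lemma cs_table_nth (i : nat) (q a c1 c2 c3 c4 c5 : int) (x0 := (0, 0, 0, 0, 0, true)) :
  (i < size (cs_table q a))%N ->
  (let: (d1, d2, d3, d4, d5, _) := nth x0 (cs_table q a) i in
   [/\ c1 = d1, c2 = d2, c3 = d3, c4 = d4 & c5 = d5]) ->
  exists a p, (c1, c2, c3, c4, c5, p) \in cs_table q a.
Proof.
move=> lt_i; case et: (nth _ _ _) => [[[[[d1 d2] d3] d4] d5] p] [-> -> -> -> ->].
by exists a, p; rewrite -et mem_nth.
Qed.

Lemma table_complete0 (c1 c2 c3 c4 : int) (e := 2 + c1 + c2 + c3 + c4 + c1)
    (pm1 := fun x : int => x = 1 \/ x = -1) :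
  pm1 e -> pm1 (pairs_form c1 c2 c3 c4 c1) -> pm1 (triples_form c1 c2 c3 c4 c1) ->
  exists a p, (c1, c2, c3, c4, c1, p) \in cs_table 0 a.
Proof.
rewrite {}/pm1; pose r := c4 - c2; have ec4 : c4 = c2 + r by rewrite /r; lia.
have ec3 : c3 = e - 2 - 2 * c1 - 2 * c2 - r by rewrite /e /r; lia.
move: e r ec4 ec3 => e r -> -> he.
have -> x : pairs_form c1 c2 x (c2 + r) c1 = - r ^+ 3 by rewrite /pairs_form; ring.
move=> hd; have hr : r = 1 \/ r = -1.
  have : -1 <= r <= 1 by case: hd; nia.
  by case: (eqVneq r 0) hd => [->|]; [case|]; lia.
rewrite /triples_form {hd} => ht.
(* Modulo 2 the triples equation reads [c1 ^ 2 = 1], so [c1] is odd; modulo 4 it then forces the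
   value [- e], and it determines [c2]. *)
have [a [] ea] : exists a, c1 = 2 * a \/ c1 = 2 * a + 1.
- by exists (c1 %/ 2)%Z; lia.
- by rewrite ea in ht; case: he hr ht => -> [->|->] [|]; lia.
rewrite {}ea in ht *.
case: he ht => ->; case: hr => -> ht.
- by apply: (@cs_table_nth 2 0 a) => //=; split; lia.
- by apply: (@cs_table_nth 0 0 a) => //=; split; lia.
- by apply: (@cs_table_nth 3 0 a) => //=; split; lia.
- by apply: (@cs_table_nth 1 0 a) => //=; split; lia.
Qed.

(** The pairs form is [(r + 2) * x + e]. Either it equals [e] and a factor vanishes, which gives the
    families, or [(r + 2) * x = - 2 * e], which leaves four values of [r] for the search. *)
Lemma table_complete1 (c1 c2 c3 c4 : int) (e := 2 + c1 + c2 + c3 + c4 + (c1 + 1))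
    (pm1 := fun x : int => x = 1 \/ x = -1) :
  pm1 e -> pm1 (pairs_form c1 c2 c3 c4 (c1 + 1)) -> pm1 (triples_form c1 c2 c3 c4 (c1 + 1)) ->
  exists a p, (c1, c2, c3, c4, c1 + 1, p) \in cs_table 1 a.
Proof.
rewrite {}/pm1 => he hd ht; pose r := c4 - c2.
have epairs : pairs_form c1 c2 c3 c4 (c1 + 1)
    = (r + 2) * (c1 * (r - 2) - c2 - r ^+ 2 + 2 * r - 2) + e.
  by rewrite /pairs_form /e /r; ring.
have [eqde|neq_de] := eqVneq (pairs_form c1 c2 c3 c4 (c1 + 1)) e.
- have ec4 : c4 = c2 + r by rewrite /r; lia.
  have ec3 : c3 = e - 3 - 2 * c1 - 2 * c2 - r by rewrite /e /r; lia.
  have {}eqde : (r + 2) * (c1 * (r - 2) - c2 - r ^+ 2 + 2 * r - 2) == 0.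
    by rewrite -(addrK e (_ * _)) -epairs eqde subrr.
  rewrite {epairs hd}.
  move: e r ec4 ec3 he eqde ht => e r -> -> he eqde ht.
  move: eqde; rewrite mulf_eq0 => /orP[/eqP er|/eqP ec2].
    have {er} er : r = -2 by lia.
    rewrite {}er /triples_form in ht *.
    (* The coefficient of [c2] in the triples equation is [4 * e - 1], that is 3 or -5; hence the
       residues of [c1] modulo 3 or 5, one of which is impossible in each case. *)
    case: he ht => -> ht.
      have [a [|[|]] ea] : exists a, c1 = 3 * a - 1 \/ c1 = 3 * a \/ c1 = 3 * a + 1.
      + by exists ((c1 + 1) %/ 3)%Z; lia.
      + by rewrite ea in ht *; apply: (@cs_table_nth 0 1 a) => //=; split; lia.
      + by rewrite ea in ht *; apply: (@cs_table_nth 1 1 a) => //=; split; lia.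
      + by exfalso; rewrite ea in ht *; lia.
    have [a [|[|[|[|]]]] ea] : exists a, c1 = 5 * a - 2 \/ c1 = 5 * a - 1 \/ c1 = 5 * a
        \/ c1 = 5 * a + 1 \/ c1 = 5 * a + 2.
    + by exists ((c1 + 2) %/ 5)%Z; lia.
    + by rewrite ea in ht *; apply: (@cs_table_nth 8 1 a) => //=; split; lia.
    + by rewrite ea in ht *; apply: (@cs_table_nth 9 1 a) => //=; split; lia.
    + by rewrite ea in ht *; apply: (@cs_table_nth 10 1 a) => //=; split; lia.
    + by exfalso; rewrite ea in ht *; lia.
    + by rewrite ea in ht *; apply: (@cs_table_nth 11 1 a) => //=; split; lia.
  have {ec2} ec2 : c2 = c1 * (r - 2) - r ^+ 2 + 2 * r - 2 by lia.
  pose w := c1 - 2 * r; have ec1 : c1 = w + 2 * r by rewrite /w; lia.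
  move: w ec1 => w ec1; rewrite {}ec1 in ec2 ht *; rewrite {}ec2 in ht *.
  case: he ht => -> ht.
    move: ht; rewrite (_ : triples_form _ _ _ _ _ = - (w ^+ 2 + 5 * w + 7)); last first.
      by rewrite /triples_form; ring.
    (* The value 1 would give [w ^ 2 + 5 * w + 8 = 0], of discriminant -7. *)
    case=> ew; first by exfalso; have := sqr_ge0 (2 * w + 5); lia.
    have /eqP : (w + 2) * (w + 3) = 0 by lia.
    rewrite mulf_eq0 !addr_eq0 => /orP[] /eqP ew'; rewrite {}ew' {ew}.
      by apply: (@cs_table_nth 3 1 (r - 1)) => //=; split; lia.
    by apply: (@cs_table_nth 2 1 (r - 1)) => //=; split; lia.
  move: ht; rewrite (_ : triples_form _ _ _ _ _ = w ^+ 2 + 5 * w + 5); last first.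
    by rewrite /triples_form; ring.
  case=> ew.
    have /eqP : (w + 1) * (w + 4) = 0 by lia.
    rewrite mulf_eq0 !addr_eq0 => /orP[] /eqP ew'; rewrite {}ew' {ew}.
      by apply: (@cs_table_nth 12 1 r) => //=; split; lia.
    by apply: (@cs_table_nth 15 1 (r - 2)) => //=; split; lia.
  have /eqP : (w + 2) * (w + 3) = 0 by lia.
  rewrite mulf_eq0 !addr_eq0 => /orP[] /eqP ew'; rewrite {}ew' {ew}.
    by apply: (@cs_table_nth 13 1 (r - 1)) => //=; split; lia.
  by apply: (@cs_table_nth 14 1 (r - 1)) => //=; split; lia.
- have {}hd : pairs_form c1 c2 c3 c4 (c1 + 1) = - e.
    by move: neq_de; case: he hd => -> [->|->].
  have hu : r + 2 = 1 \/ r + 2 = -1 \/ r + 2 = 2 \/ r + 2 = -2.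
    rewrite {}epairs in hd; move: (c1 * (r - 2) - c2 - r ^+ 2 + 2 * r - 2) hd => x hd.
    have e2 : (`|(r + 2)%R| * `|x|)%N = 2%N.
      have : (r + 2) * x = 2 \/ (r + 2) * x = -2 by case: he hd => ->; lia.
      by rewrite -abszM; case=> ->.
    have : (`|(r + 2)%R| <= 2)%N by rewrite dvdn_leq // -[X in (_ %| X)%N]e2 dvdn_mulr.
    have : `|(r + 2)%R|%N != 0%N by apply: contra_eq_neq e2 => ->.
    by lia.
  have hs : search_ok (tableZ 1) (Z_of_int 1) (Z_of_int e) (- Z_of_int e)
      (Z_of_int (triples_form c1 c2 c3 c4 (c1 + 1))) (Z_of_int (r + 2)).
    by case: he => ->; case: ht => ->; case: hu => [->|[->|[->|->]]]; vm_compute.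
  apply: tableZ_mem.
  have := @search_okP _ _ _ _ _ _ (Z_of_int c1) (Z_of_int c2) _ _ _ hs.
  rewrite (_ : Z.sub _ _ = Z_of_int r); last by lia.
  have e1 : c1 + 1 - c1 = 1 by lia.
  have ht1 := triplesZE he; have hp1 := pairsZE c1 c2 c3 c4 (c1 + 1).
  rewrite e1 in ht1 hp1 => hm.
  have q0 : Z_of_int 1 <> Z0 by [].
  have e0 : Z_of_int e <> Z0 by case: he => ->.
  have u0 : Z_of_int (r + 2) <> Z0 by case: hu => [->|[->|[->|->]]].
  have {}hp1 := etrans hp1 (congr1 Z_of_int hd); rewrite raddfN in hp1.
  have := hm q0 e0 u0 hp1 ht1; set t := (X in X \in _) => ht'.
  by rewrite (_ : (_, _) = t) // /t; congr (_, _, _, _, _); rewrite /r /e; lia.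
Qed.

Lemma table_complete (c1 c2 c3 c4 c5 : int) (e := 2 + c1 + c2 + c3 + c4 + c5)
    (pm1 := fun x : int => x = 1 \/ x = -1) :
  0 <= c5 - c1 <= 12 ->
  pm1 e -> pm1 (pairs_form c1 c2 c3 c4 c5) -> pm1 (triples_form c1 c2 c3 c4 c5) ->
  exists a p, (c1, c2, c3, c4, c5, p) \in cs_table (c5 - c1) a.
Proof.
rewrite {}/pm1; case eq: (c5 - c1) => [q|//] hq he hd ht.
have {}eq : c5 = c1 + q%:Z by lia.
case: (ltnP 1 q) => [q2|]; last first.
  case: q => [|[|//]] in hq eq * => _.
    have {eq} ec : c5 = c1 by lia.
    by move: he hd ht; rewrite /e ec; apply: table_complete0.
  by move: he hd ht; rewrite /e eq; apply: table_complete1.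
have {}hq : (2 <= q <= 12)%N by lia.
have hp1 := pairsZE c1 c2 c3 c4 c5; have ht1 := triplesZE he.
have e1 : Z_of_int (c5 - c1) = Z.of_nat q by rewrite eq; lia.
apply: tableZ_mem; rewrite e1 in ht1 hp1.
have := @table_complete_ge2 q (Z_of_int e) (Z_of_int (c4 - c2)) (Z_of_int c1) (Z_of_int c2) hq.
rewrite hp1 ht1; set t := (X in X \in _) => hm.
rewrite (_ : (_, _) = t); last by rewrite /t eq; congr (_, _, _, _, _); rewrite /e; lia.
by apply: hm; [case: he|case: hd|case: ht] => ->; [left|right|left|right|left|right].
Qed.

(** * Positivity *)

Definition sextic (c1 c2 c3 c4 c5 : int) : {poly int} :=
  'X^6 + c5 *: 'X^5 + c4 *: 'X^4 + c3 *: 'X^3 + c2 *: 'X^2 + c1 *: 'X + 1.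

Lemma positive_sexticP (R : realType) (c1 c2 c3 c4 c5 : int) :
  positive_poly R 6 (sextic c1 c2 c3 c4 c5) <->
  forall s : R, 0 < s -> 0 < s ^+ 6 - c5%:~R * s ^+ 5 + c4%:~R * s ^+ 4 - c3%:~R * s ^+ 3
                            + c2%:~R * s ^+ 2 - c1%:~R * s + 1.
Proof.
have E (t : R) : (-1) ^+ 6 * (map_poly (intr : int -> R) (sextic c1 c2 c3 c4 c5)).[t]
    = t ^+ 6 + c5%:~R * t ^+ 5 + c4%:~R * t ^+ 4 + c3%:~R * t ^+ 3
      + c2%:~R * t ^+ 2 + c1%:~R * t + 1.
  rewrite -signr_odd expr0 mul1r /sextic !rmorphD /= !linearZ /= !map_polyXn map_polyX rmorph1.
  by rewrite !hornerE.
split=> h s s0.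
  by have := h (- s); rewrite E oppr_lt0 => /(_ s0); congr (0 < _); ring.
have := h (- s); rewrite oppr_gt0 E => /(_ s0); congr (0 < _); ring.
Qed.

(** At [t = - s] every term is nonnegative, and the constant term 1 makes the sum positive. *)
Lemma positive_alternating (R : realType) (c1 c2 c3 c4 c5 : int) :
  [&& c1 <= 0, 0 <= c2, c3 <= 0, 0 <= c4 & c5 <= 0] ->
  positive_poly R 6 (sextic c1 c2 c3 c4 c5).
Proof.
case/and5P=> [h1 h2 h3 h4 h5].
rewrite -(ler_int R) mulr0z in h1; rewrite -(ler_int R) mulr0z in h2.
rewrite -(ler_int R) mulr0z in h3; rewrite -(ler_int R) mulr0z in h4.
rewrite -(ler_int R) mulr0z in h5.
apply/positive_sexticP => s s0; have p0 k : 0 <= s ^+ k by rewrite exprn_ge0 ?ltW.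
have := mulr_le0_ge0 h1 (ltW s0); have := mulr_ge0 h2 (p0 2); have := mulr_le0_ge0 h3 (p0 3).
have := mulr_ge0 h4 (p0 4); have := mulr_le0_ge0 h5 (p0 5); have := p0 6.
lra.
Qed.

(* m^6 f(- n / m) for f = sextic c1 c2 c3 c4 c5 *)
Definition sextic_form (R : comNzRingType) (c1 c2 c3 c4 c5 n m : R) : R :=
  n ^+ 6 - c5 * n ^+ 5 * m + c4 * n ^+ 4 * m ^+ 2 - c3 * n ^+ 3 * m ^+ 3
  + c2 * n ^+ 2 * m ^+ 4 - c1 * n * m ^+ 5 + m ^+ 6.

Lemma rmorph_sextic_form (R S : comNzRingType) (f : {rmorphism R -> S}) (c1 c2 c3 c4 c5 n m : R) :
  f (sextic_form c1 c2 c3 c4 c5 n m)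
    = sextic_form (f c1) (f c2) (f c3) (f c4) (f c5) (f n) (f m).
Proof. by rewrite /sextic_form; ring. Qed.

Lemma not_positive (R : realType) (n m c1 c2 c3 c4 c5 : int) :
  0 < n -> 0 < m -> sextic_form c1 c2 c3 c4 c5 n m <= 0 ->
  ~ positive_poly R 6 (sextic c1 c2 c3 c4 c5).
Proof.
move=> n0 m0 le0; rewrite -(ltr_int R) in n0; rewrite -(ltr_int R) in m0.
rewrite -(ler_int R) in le0 => /positive_sexticP/(_ _ (divr_gt0 n0 m0)).
have m6 : 0 < (m%:~R : R) ^+ 6 by rewrite exprn_gt0.
rewrite -(pmulr_lgt0 _ m6); apply/negP; rewrite -leNgt; apply: le_trans le0.
rewrite le_eqVlt; apply/orP; left; apply/eqP; rewrite rmorph_sextic_form /sextic_form.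
by field; rewrite gt_eqF.
Qed.

(** Positive polynomials without alternating coefficients: eleven members of the families with
    [q = 0] or [q = 1], for [a] between 0 and 3, then one entry with [q = 2] and one with
    [q = 4]. *)
Definition exceptional : seq (int * int * int * int * int) :=
    [:: (1, 0, -2, -1, 1); (1, -1, -2, 0, 1); (0, -1, -1, 0, 1); (-1, 0, 0, -2, 0);
        (0, -1, -3, 0, 1); (0, -2, -2, 0, 1); (2, -2, -6, 0, 3); (1, -2, -4, 0, 2);
        (4, -1, -13, 2, 5); (3, -2, -9, 1, 4); (5, 0, -18, 4, 6);
        (-1, -2, -2, 1, 1); (-1, -3, -2, 2, 3)].

(* Certificates of the form p = (s^3 + al s^2 + be s + ga)^2 + (squares weighted by powers of s)
   + (a polynomial in s with nonnegative coefficients). *)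
Lemma positive_exceptional (R : realType) (c1 c2 c3 c4 c5 : int) :
  (c1, c2, c3, c4, c5) \in exceptional ->
  positive_poly R 6 (sextic c1 c2 c3 c4 c5).
Proof.
move=> h; apply/positive_sexticP => s s0.
have s2 : 0 < s ^+ 2 by rewrite exprn_gt0.
have s3 : 0 < s ^+ 3 by rewrite exprn_gt0.
have s4 : 0 < s ^+ 4 by rewrite exprn_gt0.
have sq al be ga := sqr_ge0 (s ^+ 3 + al * s ^+ 2 + be * s + ga).
have sq1 x := mulr_ge0 (ltW s0) (sqr_ge0 (s - x)).
have sq2 x := mulr_ge0 (ltW s2) (sqr_ge0 (s - x)).
move: h; rewrite !inE.
case/predU1P=> [[-> -> -> -> ->]|].
  by have := sq (-1/2) (-5/8) 0; have := sq1 (3/5); have := sqr_ge0 (1 - 3/4 * s); lra.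
case/predU1P=> [[-> -> -> -> ->]|].
  by have := sq (-1/2) (-1/8) 0; have := sq1 (1/2); have := sqr_ge0 (1 - 11/15 * s); lra.
case/predU1P=> [[-> -> -> -> ->]|].
  by have := sq (-1/2) (-1/8) 0; have := sq1 1; have := sqr_ge0 (1 - 7/16 * s); lra.
case/predU1P=> [[-> -> -> -> ->]|].
  by have := sq 0 (-1) (-1/4); have := sq1 1; lra.
case/predU1P=> [[-> -> -> -> ->]|].
  by have := sq (-1/2) (-1/8) 1; have := sq1 (1/64); lra.
case/predU1P=> [[-> -> -> -> ->]|].
  by have := sq (-1/2) (-1/8) 0; have := sq1 (4/5); have := sqr_ge0 (1 - 3/5 * s); lra.
case/predU1P=> [[-> -> -> -> ->]|].
  by have := sq (-3/2) (-9/8) 1; have := sq1 (1/4); lra.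
case/predU1P=> [[-> -> -> -> ->]|].
  by have := sq (-1) (-3/4) 1; have := sq1 (3/5); lra.
case/predU1P=> [[-> -> -> -> ->]|].
  by have := sq (-5/2) (-17/8) 1; have := sq1 (7/10); lra.
case/predU1P=> [[-> -> -> -> ->]|].
  by have := sq (-2) (-13/8) 1; have := sq1 (13/20); lra.
case/predU1P=> [[-> -> -> -> ->]|].
  by have := sq (-3) (-41/16) 1; have := sq1 (41/100); have := sq2 (9/20); lra.
case/predU1P=> [[-> -> -> -> ->]|].
  by have := sq (-1/2) 0 0; have := sq1 (1/2); lra.
case/eqP=> -> -> -> -> ->.
by have := sq (-3/2) (-1/8) (1/2); have := sq1 (5/4); lra.
Qed.

Lemma iff_le (P : Prop) (a k : int) : (a <= k -> P) -> (k < a -> ~ P) -> P <-> a <= k.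
Proof. by move=> pos neg; split=> // hp; rewrite leNgt; apply/negP => /neg. Qed.

Lemma lt_shift (k a : int) : k < a ->
  exists2 b, a = b + k + 1 & forall i, 0 <= b ^+ i.
Proof.
by move=> lt_ka; exists (a - k - 1) => [|i]; [ring|apply: exprn_ge0; lia].
Qed.

(* As a polynomial in b = a - k - 1, the homogenized value of f at - n / m has only
   nonpositive coefficients. *)
Ltac nonpos_entry a n m ha :=
  apply: (not_positive (n := n) (m := m)); [by lia|by lia|rewrite /sextic_form];
  have [b -> b0] := lt_shift ha;
  have := b0 1%N; have := b0 2%N; have := b0 3%N; have := b0 4%N; have := b0 5%N;
  have := b0 6%N; clear; lra.

(** This fails for reals between -1 and 0. It supplies [a ^ 2 >= - a], after which the signs of the
    coefficients follow linearly from [a] and [a ^ 2]. *)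
Lemma mulz_succ_ge0 (a : int) : 0 <= a * (a + 1).
Proof. by nia. Qed.

Ltac alternating_entry a :=
  apply/positive_alternating/and5P; have := sqr_ge0 a; have := mulz_succ_ge0 a;
  rewrite mulrDr mulr1 -expr2; move: (a ^+ 2) => y ? ?; split; lia.

Lemma cs_table0_positive (R : realType) (a c1 c2 c3 c4 c5 : int) (p : bool) :
  (c1, c2, c3, c4, c5, p) \in cs_table 0 a ->
  (positive_poly R 6 (sextic c1 c2 c3 c4 c5) <-> p).
Proof.
rewrite /= !inE.
case/predU1P=> [[-> -> -> -> -> ->]|].
  apply: iff_le => ha.
    case: (eqVneq a 0) => [->|a0]; first by apply: positive_exceptional.
    by alternating_entry a.
  (* In [f(- s)] the terms of top total degree in [s] and [a] form [s ^ 4 * (s - a) ^ 2], so a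
     nonpositive value is sought near [s = a]. *)
  nonpos_entry a (a + 1) (1 : int) ha.
case/predU1P=> [[-> -> -> -> -> ->]|].
  apply: iff_le => ha.
    by alternating_entry a.
  nonpos_entry a (a + 1) (1 : int) ha.
case/predU1P=> [[-> -> -> -> -> ->]|].
  apply: iff_le => ha.
    case: (eqVneq a 0) => [->|a0]; first by apply: positive_exceptional.
    by alternating_entry a.
  (* Here the low-degree terms decide: for small [s] they are close to [(1 - a * s) ^ 2], so [s] is
     taken near [1 / a]. *)
  nonpos_entry a (1 : int) (a + 1) ha.
case/eqP=> -> -> -> -> -> ->.
apply: iff_le => ha.
  by alternating_entry a.
nonpos_entry a (a + 1) (1 : int) ha.
Qed.

Lemma cs_table1_positive (R : realType) (a c1 c2 c3 c4 c5 : int) (p : bool) :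
  (c1, c2, c3, c4, c5, p) \in cs_table 1 a ->
  (positive_poly R 6 (sextic c1 c2 c3 c4 c5) <-> p).
Proof.
rewrite /= !inE.
case/predU1P=> [[-> -> -> -> -> ->]|].
  split=> // _; apply/positive_sexticP => s s0.
  rewrite !(rmorphD, rmorphB, rmorphN, rmorphM, rmorphXn) /=.
  move: (a%:~R : R) => x.
  have pw k : 0 < s ^+ k by rewrite exprn_gt0.
  (* completing the square in a *)
  have := sqr_ge0 (s * (s + 1) * x - (s + 1) * (3 * s ^+ 2 - 5 * s + 3) / 6).
  have := pw 2%N; have := pw 3%N; have := pw 4%N; have := pw 5%N; have := pw 6%N; lra.
case/predU1P=> [[-> -> -> -> -> ->]|].
  split=> // _; apply/positive_sexticP => s s0.
  rewrite !(rmorphD, rmorphB, rmorphN, rmorphM, rmorphXn) /=.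
  move: (a%:~R : R) => x.
  have pw k : 0 < s ^+ k by rewrite exprn_gt0.
  have := sqr_ge0 (s * (s + 1) * x - (s + 1) * (3 * s ^+ 2 - 7 * s + 3) / 6).
  have := pw 2%N; have := pw 3%N; have := pw 4%N; have := pw 5%N; have := pw 6%N; lra.
case/predU1P=> [[-> -> -> -> -> ->]|].
  apply: iff_le => ha.
    by alternating_entry a.
  nonpos_entry a (1 : int) a ha.
case/predU1P=> [[-> -> -> -> -> ->]|].
  apply: iff_le => ha.
    case: (eqVneq a 0) => [->|a0]; first by apply: positive_exceptional.
    by alternating_entry a.
  nonpos_entry a (a + 1) (1 : int) ha.
case/predU1P=> [[-> -> -> -> -> ->]|]; first by split=> // _; apply: positive_alternating.
case/predU1P=> [[-> -> -> -> -> ->]|]; first by split=> // _; apply: positive_alternating.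
case/predU1P=> [[-> -> -> -> -> ->]|]; first by split=> // _; apply: positive_alternating.
case/predU1P=> [[-> -> -> -> -> ->]|]; first by split=> // _; apply: positive_alternating.
case/predU1P=> [[-> -> -> -> -> ->]|].
  apply: iff_le => ha.
    by alternating_entry a.
  (* The top part is now [s ^ 4 * (s ^ 2 - 5 * a * s + 5 * a ^ 2)], negative at [s = 2 * a]. *)
  nonpos_entry a (2 * a) (1 : int) ha.
case/predU1P=> [[-> -> -> -> -> ->]|].
  apply: iff_le => ha.
    case: (eqVneq a 0) => [->|a0]; first by apply: positive_exceptional.
    by alternating_entry a.
  nonpos_entry a (2 * a) (1 : int) ha.
case/predU1P=> [[-> -> -> -> -> ->]|].
  apply: iff_le => ha.
    by alternating_entry a.
  nonpos_entry a (2 * a + 1) (1 : int) ha.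
case/predU1P=> [[-> -> -> -> -> ->]|].
  apply: iff_le => ha.
    by alternating_entry a.
  nonpos_entry a (2 * a + 1) (1 : int) ha.
case/predU1P=> [[-> -> -> -> -> ->]|].
  apply: iff_le => ha.
    by alternating_entry a.
  nonpos_entry a a (1 : int) ha.
case/predU1P=> [[-> -> -> -> -> ->]|].
  apply: iff_le => ha.
    case: (eqVneq a 0) => [->|a0]; first by apply: positive_exceptional.
    case: (eqVneq a 1) => [->|a1]; first by apply: positive_exceptional.
    case: (eqVneq a 2) => [->|a2]; first by apply: positive_exceptional.
    by alternating_entry a.
  (* At [a = 3] the point [s = a + 4 / 3] used for larger [a] gives a positive value, so [17 / 4]
     replaces it. *)
  case: (eqVneq a 3) => [->|a3].
    by apply: (not_positive (n := 17) (m := 4)); rewrite /sextic_form; lra.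
  have {}ha : 3 < a by lia.
  nonpos_entry a (3 * a + 4) (3 : int) ha.
case/predU1P=> [[-> -> -> -> -> ->]|].
  apply: iff_le => ha.
    case: (eqVneq a 1) => [->|a1]; first by apply: positive_exceptional.
    case: (eqVneq a 2) => [->|a2]; first by apply: positive_exceptional.
    case: (eqVneq a 3) => [->|a3]; first by apply: positive_exceptional.
    by alternating_entry a.
  nonpos_entry a (2 : int) (2 * a + 1) ha.
case/eqP=> -> -> -> -> -> ->.
apply: iff_le => ha.
  case: (eqVneq a 0) => [->|a0]; first by apply: positive_exceptional.
  by alternating_entry a.
nonpos_entry a (a + 1) (1 : int) ha.
Qed.

(** * Numeric entries and soundness of the table *)

Definition witnesses : seq (nat * nat) :=
  [:: (1, 1); (1, 2); (1, 3); (2, 1); (3, 1); (4, 1); (5, 1); (6, 1); (7, 1); (8, 1); (9, 1);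
      (11, 1); (19, 1)]%N.

(** The forms are evaluated in [Z], whose binary integers compute fast. A pair [(n, m)] of
    [witnesses] stands for the point [- n / m]. *)
Definition numeric_entry_ok (t : int * int * int * int * int * bool) : bool :=
  let: (c1, c2, c3, c4, c5, p) := t in
  let d1 := Z_of_int c1 in let d2 := Z_of_int c2 in let d3 := Z_of_int c3 in
  let d4 := Z_of_int c4 in let d5 := Z_of_int c5 in
  let pm1 (x : Z) := (x == 1) || (x == -1) in
  [&& pm1 (2 + d1 + d2 + d3 + d4 + d5), pm1 (pairs_form d1 d2 d3 d4 d5),
      pm1 (triples_form d1 d2 d3 d4 d5) &
      if p then [&& c1 <= 0, 0 <= c2, c3 <= 0, 0 <= c4 & c5 <= 0]
                || ((c1, c2, c3, c4, c5) \in exceptional)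
      else has (fun w => Z.leb (sextic_form d1 d2 d3 d4 d5 (Z_of_int w.1%:Z) (Z_of_int w.2%:Z)) Z0)
             witnesses].

Lemma numeric_entries_ok (q : nat) (a : int) : (2 <= q)%N -> all numeric_entry_ok (cs_table q a).
Proof.
move=> q2; case: (leqP q 12) => q12; last first.
  suff -> : cs_table q a = [::] by [].
  by case: q q12 {q2} => [|[|[|[|[|[|[|[|[|[|[|[|[|q]]]]]]]]]]]]].
have /allP h : all (fun q : nat => all numeric_entry_ok (cs_table q 0)) (iota 2 11).
  by vm_cast_no_check (erefl true).
have -> : cs_table q a = cs_table q 0.
  by case: q q12 q2 => [|[|[|[|[|[|[|[|[|[|[|[|[|q]]]]]]]]]]]]].
by apply: h; rewrite mem_iota q2.
Qed.

(** For [q >= 2] this is a computation; in the families the three forms are constant as polynomials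
    in [a]. *)
Lemma cs_table_sound (q : nat) (a c1 c2 c3 c4 c5 : int) (p : bool)
    (pm1 := fun x : int => x = 1 \/ x = -1) :
  (c1, c2, c3, c4, c5, p) \in cs_table q a ->
  [/\ pm1 (2 + c1 + c2 + c3 + c4 + c5), pm1 (pairs_form c1 c2 c3 c4 c5)
    & pm1 (triples_form c1 c2 c3 c4 c5)].
Proof.
rewrite {}/pm1; case: (ltnP 1 q) => [q2 /(allP (numeric_entries_ok a q2))/and4P[]|].
  have pm1Z (x : int) : (Z_of_int x == 1) || (Z_of_int x == -1) -> x = 1 \/ x = -1.
    by case/orP=> /eqP; [left|right]; lia.
  rewrite -(rmorph_pairs_form Z_of_int) -(rmorph_triples_form Z_of_int).
  rewrite -(rmorph_nat Z_of_int 2) -!rmorphD.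
  by move=> /pm1Z h1 /pm1Z h2 /pm1Z h3 _.
rewrite /pairs_form /triples_form.
case: q => [|[|//]] _; rewrite /= !inE.
  do 3!(case/predU1P=> [[-> -> -> -> -> _]|]; first by
    split; first [left; ring | right; ring]).
  case/eqP=> -> -> -> -> -> _; split; first [left; ring | right; ring].
do 4!(case/predU1P=> [[-> -> -> -> -> _]|]; first by
  split; first [left; ring | right; ring]).
do 4!(case/predU1P=> [[-> -> -> -> -> _]|]; first by
  split; first [left; lia | right; lia]).
do 7!(case/predU1P=> [[-> -> -> -> -> _]|]; first by
  split; first [left; ring | right; ring]).
case/eqP=> -> -> -> -> -> _; split; first [left; ring | right; ring].
Qed.

Lemma cs_table_positive (R : realType) (q : nat) (a c1 c2 c3 c4 c5 : int) (p : bool) :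
  (c1, c2, c3, c4, c5, p) \in cs_table q a ->
  (positive_poly R 6 (sextic c1 c2 c3 c4 c5) <-> p).
Proof.
case: (ltnP 1 q) => [q2 /(allP (numeric_entries_ok a q2))/and4P[_ _ _]|].
  case: p => [/orP[/positive_alternating|/positive_exceptional] //|].
  case/hasP=> w hw; rewrite -(rmorph_sextic_form Z_of_int) => le0; split=> // hp; exfalso; move: hp.
  have [n0 m0] : (0 < w.1)%N /\ (0 < w.2)%N.
    by have /(_ _ hw)/andP := allP (isT : all (fun w => (0 < w.1) && (0 < w.2))%N witnesses).
  have {}le0 : sextic_form c1 c2 c3 c4 c5 w.1%:Z w.2%:Z <= 0.
    have le0P (x : int) : Z.le (Z_of_int x) Z0 -> x <= 0 by lia.
    by apply/le0P/Z.leb_le.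
  exact: (@not_positive R w.1%:Z w.2%:Z).
by case: q => [|[|//]] _; [apply: cs_table0_positive|apply: cs_table1_positive].
Qed.

Theorem proposition6p1 (R : realType) (c0 c1 c2 c3 c4 c5 : int)
    (f : {poly int})
    (hf : f = 'X^6 + c5 *: 'X^5 + c4 *: 'X^4 + c3 *: 'X^3 + c2 *: 'X^2
              + c1 *: 'X + c0%:P)
    (hq : 0 <= c5 - c1 <= 12) :
  (cappell_shaneson_poly 6 f <->
     c0 = 1 /\
     exists (a : int) (p : bool),
       (c1, c2, c3, c4, c5, p) \in cs_table (c5 - c1) a)
  /\
  (c0 = 1 ->
   forall (a : int) (p : bool),
     (c1, c2, c3, c4, c5, p) \in cs_table (c5 - c1) a ->
     (positive_poly R 6 f <-> p)).
Proof.
split.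
  rewrite (cappell_shaneson_poly6P hf); split=> -[->].
    by move=> [h1 h2 h3]; split=> //; apply: table_complete.
  move=> [a [p hp]]; split=> //.
  by case: (c5 - c1) hp => // q; apply: cs_table_sound.
move=> c01 a p; rewrite hf c01; case: (c5 - c1) => // q.
exact: cs_table_positive.
Qed.
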